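(* Let $A\;_Q\otimes_R B$ be an L-R-twisted tensor product of algebras, with $R(b\otimes a)=a_R\otimes b_R$, $Q(a\otimes b)=a_Q\otimes b_Q$. Assume we are given linear maps $\mu_l:B\otimes A\to A$, $b\otimes a\mapsto b\cdot a$; $\mu_r:A\otimes B\to A$, $a\otimes b\mapsto a\cdot b$; $\rho_r:A\to A\otimes B$, $\rho_r(a)=a_{(0)}\otimes a_{(1)}$; $\rho_l:A\to B\otimes A$, $\rho_l(a)=a_{<-1>}\otimes a_{<0>}$; and denote $a\bullet a':=(a_{(0)}\cdot a'_{<-1>})(a_{(1)}\cdot a'_{<0>})$ for $a,a'\in A$. Assume that $\rho_r(1)=1\otimes 1$, $\rho_l(1)=1\otimes 1$, $1\cdot a=a=a\cdot 1$, $a_{(0)}(a_{(1)}\cdot 1)=a$, $(1\cdot a_{<-1>})a_{<0>}=a$, and, for all $a,a'\in A$, $b\in B$, \begin{align*} &b\cdot (a_{(0)}(a_{(1)}\cdot a'))=a_{(0)_R}(b_Ra_{(1)}\cdot a'),\\ &((a\cdot a'_{<-1>})a'_{<0>})\cdot b=(a\cdot a'_{<-1>}b_Q)a'_{<0>_Q},\\ &\rho_r(a\bullet a')=(a_{(0)}\cdot a'_{(0)_{R_{<-1>}}})a'_{(0)_{R_{<0>}}}\otimes a_{(1)_R}a'_{(1)},\\ &\rho_l(a\bullet a')=a_{<-1>}a'_{<-1>_Q}\otimes a_{<0>_{Q_{(0)}}}(a_{<0>_{Q_{(1)}}}\cdot a'_{<0>}),\\ &a_{(0)_{<-1>}}\otimes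 a_{(0)_{<0>}}\otimes a_{(1)}=a_{<-1>}\otimes a_{<0>_{(0)}}\otimes a_{<0>_{(1)}},\\ &a_{Q_{(0)}}\otimes a_{Q_{(1)}}\otimes b_Q=a_{(0)_Q}\otimes a_{(1)}\otimes b_Q,\\ &a_{R_{<-1>}}\otimes a_{R_{<0>}}\otimes b_R=a_{<-1>}\otimes a_{<0>_R}\otimes b_R. \end{align*} (Under these hypotheses $(A,\bullet,1)$ is an associative unital algebra, denoted $\tilde A$.) Assume also that we are given linear maps $\lambda_r:A\to A\otimes B$, $\lambda_r(a)=a_{[0]}\otimes a_{[1]}$, and $\lambda_l:A\to B\otimes A$, $\lambda_l(a)=a_{\{-1\}}\otimes a_{\{0\}}$, such that $\lambda_r(1)=1\otimes 1$, $\lambda_l(1)=1\otimes 1$ and the following relations hold for all $a,a'\in A$ and $b,b'\in B$: \begin{align*} &a_{(0)_{[0]}}\otimes a_{(0)_{[1]}}a_{(1)}=a\otimes 1,\\ &a_{[0]_{(0)}}\otimes a_{[0]_{(1)}}a_{[1]}=a\otimes 1,\\ &a_{<-1>}a_{<0>_{\{-1\}}}\otimes a_{<0>_{\{0\}}}=1\otimes a,\\ &a_{\{-1\}}a_{\{0\}_{<-1>}}\otimes a_{\{0\}_{<0>}}=1\otimes a,\\ &a_{[0]_{\{-1\}}}\otimes a_{[0]_{\{0\}}}\otimes a_{[1]}=a_{\{-1\}}\otimes a_{\{0\}_{[0]}}\otimes a_{\{0\}_{[1]}},\\ &a_{[0]_{<-1>}}\otimes a_{[0]_{<0>}}\otimes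 a_{[1]}=a_{<-1>}\otimes a_{<0>_{[0]}}\otimes a_{<0>_{[1]}},\\ &a_{(0)_{\{-1\}}}\otimes a_{(0)_{\{0\}}}\otimes a_{(1)}=a_{\{-1\}}\otimes a_{\{0\}_{(0)}}\otimes a_{\{0\}_{(1)}},\\ &\lambda_r(aa')=a_{[0]_{(0)}}(a_{[0]_{(1)}}\cdot a'_{R_{[0]}})\otimes a'_{R_{[1]}}a_{[1]_R},\\ &\lambda_l(aa')=a'_{\{-1\}_Q}a_{Q_{\{-1\}}}\otimes (a_{Q_{\{0\}}}\cdot a'_{\{0\}_{<-1>}})a'_{\{0\}_{<0>}},\\ &\rho_l((a\cdot a'_{<-1>})a'_{<0>})=a_{<-1>}a'_{<-1>_Q}\otimes a_{<0>_Q}a'_{<0>},\\ &a_{(0)_{<-1>_R}}a'_{(1)_Q}\otimes a_{(0)_{<0>_Q}}\otimes a'_{(0)_{<0>_R}}\otimes a'_{(0)_{<-1>}}\otimes a_{(1)}\\ &\qquad =a'_{(1)}a_{(0)_{<-1>}}\otimes a_{(0)_{<0>}}\otimes a'_{(0)_{<0>}}\otimes a'_{(0)_{<-1>}}\otimes a_{(1)},\\ &a'_{<0>_{Q_{\{-1\}_R}}}a_{(1)}\otimes a'_{<0>_{Q_{\{0\}}}}\otimes a'_{<-1>}\otimes a_{(0)_R}\otimes b_Q\\ &\qquad =a_{(1)_q}a'_{<0>_{Q_{q_{\{-1\}}}}}\otimes a'_{<0>_{Q_{q_{\{0\}}}}}\otimes a'_{<-1>}\otimes a_{(0)}\otimes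 b_Q,\\ &a_{(0)_{R_{[0]}}}\otimes a'_{<-1>}a_{(0)_{R_{[1]_Q}}}\otimes a'_{<0>_Q}\otimes a_{(1)}\otimes b_R\\ &\qquad =a_{(0)_{r_{R_{[0]}}}}\otimes a_{(0)_{r_{R_{[1]}}}}a'_{<-1>_R}\otimes a'_{<0>}\otimes a_{(1)}\otimes b_r,\\ &a_{<0>_{Q_{\{0\}_{(0)_R}}}}\otimes a_{<0>_{Q_{\{0\}_{(1)}}}}\otimes a_{<-1>}\otimes a_{<0>_{Q_{\{-1\}}}}\otimes b_R\otimes b'_Q\\ &\qquad =a_{(0)_{R_{<0>_{Q_{\{0\}}}}}}\otimes a_{(1)}\otimes a_{(0)_{R_{<-1>}}}\otimes a_{(0)_{R_{<0>_{Q_{\{-1\}}}}}}\otimes b_R\otimes b'_Q,\\ &a_{(0)_{R_{[1]}}}\otimes a_{(0)_{R_{[0]_{<0>_Q}}}}\otimes a_{(0)_{R_{[0]_{<-1>}}}}\otimes a_{(1)}\otimes b_R\otimes b'_Q\\ &\qquad =a_{(0)_{<0>_{R_{Q_{[1]}}}}}\otimes a_{(0)_{<0>_{R_{Q_{[0]}}}}}\otimes a_{(0)_{<-1>}}\otimes a_{(1)}\otimes b_R\otimes b'_Q,\\ &(a_{(0)}\cdot b')_{R_{[0]_{(0)}}}\otimes (a_{(0)}\cdot b')_{R_{[0]_{(1)}}}\otimes (a_{(0)}\cdot b')_{R_{[1]}}\otimes b_R\otimes a_{(1)}\\ &\qquad =a_{(0)_{R_{[0]_{(0)}}}}\cdot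 b'\otimes a_{(0)_{R_{[0]_{(1)}}}}\otimes a_{(0)_{R_{[1]}}}\otimes b_R\otimes a_{(1)},\\ &a'_{<-1>}\otimes (b\cdot a'_{<0>})_{Q_{\{-1\}}}\otimes (b\cdot a'_{<0>})_{Q_{\{0\}_{<-1>}}}\otimes (b\cdot a'_{<0>})_{Q_{\{0\}_{<0>}}}\otimes b'_Q\\ &\qquad =a'_{<-1>}\otimes a'_{<0>_{Q_{\{-1\}}}}\otimes a'_{<0>_{Q_{\{0\}_{<-1>}}}}\otimes b\cdot a'_{<0>_{Q_{\{0\}_{<0>}}}}\otimes b'_Q. \end{align*} Define the maps \begin{align*} &\tilde R:B\otimes \tilde A\to \tilde A\otimes B,\qquad \tilde R(b\otimes a)=a_{(0)_{R_{[0]}}}\otimes a_{(0)_{R_{[1]}}}b_Ra_{(1)},\\ &\tilde Q:\tilde A\otimes B\to \tilde A\otimes B,\qquad \tilde Q(a\otimes b)=a_{<0>_{Q_{\{0\}}}}\otimes a_{<-1>}b_Qa_{<0>_{Q_{\{-1\}}}}. \end{align*} Then $\tilde A\;_{\tilde Q}\otimes_{\tilde R}B$ is an L-R-twisted tensor product of algebras and we have an algebra isomorphism $$\tilde A\;_{\tilde Q}\otimes_{\tilde R}B\simeq A\;_Q\otimes_R B,\qquad a\otimes b\mapsto a_{(0)_{<0>}}\otimes a_{(1)}ba_{(0)_{<-1>}}.$$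
   Context: All algebras, linear maps and tensor products are over a field $k$; algebras are associative and unital. Notation: for algebras $A$, $B$ and linear maps $R:B\otimes A\to A\otimes B$, $Q:A\otimes B\to A\otimes B$ write $R(b\otimes a)=a_R\otimes b_R$, $Q(a\otimes b)=a_Q\otimes b_Q$; all such notations, including those for $\rho_r,\rho_l,\lambda_r,\lambda_l$, are Sweedler-type with implicit summation. $r$, $q$ denote further independent copies of $R$, $Q$. Nested subscripts mean successive application, the subscript closest to the letter being applied first: $a_{R_Q}=(a_R)_Q$, $a_{(0)_{R_{[0]}}}=((a_{(0)})_R)_{[0]}$. The two elements carrying the same copy of $R$ (or $Q$) are the two arguments to which that map is applied. For example, $a_{(0)_{R_{[0]}}}\otimes a_{(0)_{R_{[1]}}}b_Ra_{(1)}$ is obtained by applying $\rho_r$ to $a$, then $R$ to $b\otimes a_{(0)}$ giving $(a_{(0)})_R\otimes b_R$, then $\lambda_r$ to $(a_{(0)})_R$; in $a_{(1)_R}a'_{(1)}$ together with $a'_{(0)_R}$, $R$ is applied to $a_{(1)}\otimes a'_{(0)}$; in $a'_{<-1>_Q}$ together with $a_{<0>_Q}$, $Q$ is applied to $a_{<0>}\otimes a'_{<-1>}$. The dot denotes $\mu_l$ or $\mu_r$ according to whether the element of $B$ is on the left or on the right; products are formed before the dot, e.g. $b_Ra_{(1)}\cdot a'=(b_Ra_{(1)})\cdot a'$ and $a\cdot a'_{<-1>}b_Q=a\cdot (a'_{<-1>}b_Q)$. In $1\cdot a=a=a\cdot 1$ the element $1$ is $1_B$; in $a_{(1)}\cdot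 1$ and $1\cdot a_{<-1>}$ it is $1_A$. The maps $\mu_l,\mu_r,\rho_r,\rho_l,\lambda_r,\lambda_l$ are only assumed linear with the properties listed. L-R-twisted tensor product: saying that $A\;_Q\otimes_R B$ is an L-R-twisted tensor product of algebras means that $A$, $B$ are algebras and $R:B\otimes A\to A\otimes B$, $Q:A\otimes B\to A\otimes B$ are linear maps such that, for all $a,a'\in A$, $b,b'\in B$: (1) $a_R\otimes 1_R=a\otimes 1$, $1_R\otimes b_R=1\otimes b$; (2) $(aa')_R\otimes b_R=a_Ra'_r\otimes b_{R_r}$; (3) $a_R\otimes (bb')_R=a_{R_r}\otimes b_rb'_R$; (4) $a_Q\otimes 1_Q=a\otimes 1$, $1_Q\otimes b_Q=1\otimes b$; (5) $(aa')_Q\otimes b_Q=a_qa'_Q\otimes b_{Q_q}$; (6) $a_Q\otimes (bb')_Q=a_{Q_q}\otimes b_Qb'_q$; (7) $b_R\otimes a_{R_Q}\otimes b'_Q=b_R\otimes a_{Q_R}\otimes b'_Q$; (8) $a_R\otimes b_{R_Q}\otimes a'_Q=a_R\otimes b_{Q_R}\otimes a'_Q$. Then $A\;_Q\otimes_R B$ denotes $A\otimes B$ with the associative multiplication $(a\otimes b)(a'\otimes b')=a_Qa'_R\otimes b_Rb'_Q$ (where $a_Q\otimes b'_Q=Q(a\otimes b')$, $a'_R\otimes b_R=R(b\otimes a')$) and unit $1\otimes 1$. *)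

(* Defs.v *)
From HB Require Import structures.
From mathcomp Require Import all_boot all_order all_algebra.
From mathcomp Require Import boolp.
From mathcomp Require classical_sets.

Set Implicit Arguments.
Unset Strict Implicit.
Unset Printing Implicit Defensive.

Import GRing.Theory.
Local Open Scope ring_scope.
Local Open Scope quotient_scope.

Definition bilin (k : fieldType) (V W U : lmodType k) (f : V -> W -> U) : Prop :=
  (forall w, linear (f^~ w)) /\ (forall v, linear (f v)).

Section TensorDef.
Variables (k : fieldType) (V W : lmodType k).
Implicit Types s t : seq (V * W).

(* A list [:: (v1, w1); ...; (vn, wn)] stands for the sum of the vi ⊗ wi.  Two
   lists are identified when no bilinear map separates them, so the quotient
   has the universal property of the tensor product ([sweedler_tens] and
   [tens_ind] below). *)
Definition formal_sum (U : lmodType k) (f : V -> W -> U) s : U :=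
  \sum_(p <- s) f p.1 p.2.

Definition tensor_rel s t : bool :=
  `[< forall (U : lmodType k) (f : V -> W -> U),
        bilin f -> formal_sum f s = formal_sum f t >].

Lemma tensor_rel_refl : reflexive tensor_rel.
Proof. by move=> s; apply/asboolP. Qed.

Lemma tensor_rel_sym : symmetric tensor_rel.
Proof.
by move=> s t; apply/asboolP/asboolP => H U f bf; rewrite H.
Qed.

Lemma tensor_rel_trans : transitive tensor_rel.
Proof.
move=> t s u /asboolP st /asboolP tu; apply/asboolP => U f bf.
by rewrite st // tu.
Qed.

Canonical tensor_equiv :=
  EquivRel tensor_rel tensor_rel_refl tensor_rel_sym tensor_rel_trans.

Definition tensor := {eq_quot tensor_equiv}.
HB.instance Definition _ := Choice.on tensor.
HB.instance Definition _ := EqQuotient.on tensor.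

(* [sweedler t F] is the sum of the F x y, for the implicit summation
   t = x ⊗ y; it does not depend on the chosen decomposition of t when F is
   bilinear. *)
Definition sweedler (U : lmodType k) (t : tensor) (F : V -> W -> U) : U :=
  formal_sum F (repr t).

Definition tens (v : V) (w : W) : tensor := \pi_tensor [:: (v, w)].

Lemma sweedler_pi (U : lmodType k) (f : V -> W -> U) s :
  bilin f -> sweedler (\pi s) f = formal_sum f s.
Proof.
move=> bf; rewrite /sweedler; case: piP => u /eqmodP/asboolP su.
by rewrite su.
Qed.

Lemma tensorP (x y : tensor) :
  (forall (U : lmodType k) (f : V -> W -> U),
     bilin f -> sweedler x f = sweedler y f) -> x = y.
Proof.
move=> H; rewrite -[x]reprK -[y]reprK; apply/eqmodP/asboolP => U f bf.
exact: H.
Qed.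

Definition tens_zero : tensor := \pi_tensor [::].
Definition tens_opp (x : tensor) : tensor :=
  \pi_tensor [seq (- p.1, p.2) | p <- repr x].
Definition tens_add (x y : tensor) : tensor := \pi_tensor (repr x ++ repr y).
Definition tens_scale (c : k) (x : tensor) : tensor :=
  \pi_tensor [seq (c *: p.1, p.2) | p <- repr x].

Section Formal.
Variables (U : lmodType k) (f : V -> W -> U).
Hypothesis bf : bilin f.

Lemma bilinZl c v w : f (c *: v) w = c *: f v w.
Proof.
case: bf => fl _; have f0 : f 0 w = 0.
  by have := fl w (-1) 0 0; rewrite /= scaler0 addr0 scaleN1r addNr.
by have := fl w c v 0; rewrite /= f0 !addr0.
Qed.

Lemma bilinNl v w : f (- v) w = - f v w.
Proof. by rewrite -scaleN1r bilinZl scaleN1r. Qed.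

Lemma sweedler_zero : sweedler tens_zero f = 0.
Proof. by rewrite sweedler_pi // /formal_sum big_nil. Qed.

Lemma sweedler_add x y :
  sweedler (tens_add x y) f = sweedler x f + sweedler y f.
Proof. by rewrite sweedler_pi // /formal_sum big_cat. Qed.

Lemma sweedler_opp x : sweedler (tens_opp x) f = - sweedler x f.
Proof.
rewrite sweedler_pi // /sweedler /formal_sum big_map -sumrN.
by apply: eq_bigr => p _; rewrite bilinNl.
Qed.

Lemma sweedler_scale c x : sweedler (tens_scale c x) f = c *: sweedler x f.
Proof.
rewrite sweedler_pi // /sweedler /formal_sum big_map scaler_sumr.
by apply: eq_bigr => p _; rewrite bilinZl.
Qed.
End Formal.

Definition sweedler_simp :=
  (sweedler_zero, sweedler_add, sweedler_opp, sweedler_scale).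

Lemma tens_addA : associative tens_add.
Proof. by move=> x y z; apply: tensorP => U f bf; rewrite !sweedler_simp // addrA. Qed.
Lemma tens_addC : commutative tens_add.
Proof. by move=> x y; apply: tensorP => U f bf; rewrite !sweedler_simp // addrC. Qed.
Lemma tens_add0 : left_id tens_zero tens_add.
Proof. by move=> x; apply: tensorP => U f bf; rewrite !sweedler_simp // add0r. Qed.
Lemma tens_addN : left_inverse tens_zero tens_opp tens_add.
Proof. by move=> x; apply: tensorP => U f bf; rewrite !sweedler_simp // addNr. Qed.

HB.instance Definition _ :=
  GRing.isZmodule.Build tensor tens_addA tens_addC tens_add0 tens_addN.

Lemma tens_scaleA a b v : tens_scale a (tens_scale b v) = tens_scale (a * b) v.
Proof. by apply: tensorP => U f bf; rewrite !sweedler_simp // scalerA. Qed.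
Lemma tens_scale1 : left_id 1 tens_scale.
Proof. by move=> x; apply: tensorP => U f bf; rewrite !sweedler_simp // scale1r. Qed.
Lemma tens_scaleDr : right_distributive tens_scale +%R.
Proof.
move=> c x y; apply: tensorP => U f bf.
by rewrite !(sweedler_scale, sweedler_add) // scalerDr.
Qed.
Lemma tens_scaleDl v : {morph tens_scale^~ v : a b / a + b}.
Proof.
move=> a b; apply: tensorP => U f bf.
by rewrite !(sweedler_scale, sweedler_add) // scalerDl.
Qed.

HB.instance Definition _ := GRing.Zmodule_isLmodule.Build k tensor
  tens_scaleA tens_scale1 tens_scaleDr tens_scaleDl.

End TensorDef.

Arguments sweedler {k V W U} t F.
Arguments tens {k V W} v w.

Notation "V ⨂ W" := (tensor V W) (at level 45, left associativity).
Notation "v ⊗ w" := (tens v w) (at level 45, left associativity) : ring_scope.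
Notation "\sw_ ( x , y <- t ) F" := (sweedler t (fun x y => F))
  (at level 69, x name, y name, t at level 69, F at level 69,
   format "\sw_ ( x ,  y  <-  t )  F") : ring_scope.

Section TensorTheory.
Variable k : fieldType.
Implicit Types U V W X : lmodType k.

Lemma sweedler_tens V W U (F : V -> W -> U) v w :
  bilin F -> sweedler (v ⊗ w) F = F v w.
Proof. by move=> bF; rewrite sweedler_pi // /formal_sum big_seq1. Qed.

Lemma sweedler_linear V W U (F : V -> W -> U) :
  bilin F -> linear (fun t => sweedler t F).
Proof.
move=> bF c x y.
by rewrite (sweedler_add bF (tens_scale c x) y) (sweedler_scale bF).
Qed.

Lemma linear_zero V U (h : V -> U) : linear h -> h 0 = 0.
Proof. by move=> lh; have := lh (-1) 0 0; rewrite scaler0 addr0 scaleN1r addNr. Qed.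

Lemma linear_app V W U X (h : U -> X) (t : V ⨂ W) (F : V -> W -> U) :
  linear h -> h (\sw_(x, y <- t) F x y) = \sw_(x, y <- t) h (F x y).
Proof.
move=> lh; rewrite /sweedler /formal_sum; apply: (big_morph h).
  by move=> x y; have := lh 1 x y; rewrite !scale1r.
exact: linear_zero.
Qed.

Lemma eq_sweedler V W U (t : V ⨂ W) (F G : V -> W -> U) :
  (forall x y, F x y = G x y) -> sweedler t F = sweedler t G.
Proof. by move=> FG; apply: eq_bigr => p _; apply: FG. Qed.

Lemma exchange_sweedler V W V' W' U (t : V ⨂ W) (s : V' ⨂ W')
    (F : V -> W -> V' -> W' -> U) :
  \sw_(x, y <- t) \sw_(u, v <- s) F x y u v =
  \sw_(u, v <- s) \sw_(x, y <- t) F x y u v.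
Proof. exact: exchange_big. Qed.

Lemma linear_idfun V : linear (fun x : V => x). Proof. by []. Qed.

Lemma linear_comp U V W (g : {linear V -> W}) (f : U -> V) :
  linear f -> linear (fun x => g (f x)).
Proof. by move=> lf c x y; rewrite lf linearP. Qed.

Lemma bilin_tens V W : bilin (@tens k V W).
Proof.
split=> [w|v] c x y; apply: tensorP => U f bf;
  by rewrite (sweedler_linear bf) !sweedler_tens //; case: bf => [fl fr]; rewrite ?fl ?fr.
Qed.

Lemma linear_tensl U V W (f : U -> V) (w : W) :
  linear f -> linear (fun x => f x ⊗ w).
Proof. by move=> lf c x y; rewrite lf (bilin_tens V W).1. Qed.

Lemma linear_tensr U V W (f : U -> W) (v : V) :
  linear f -> linear (fun x => v ⊗ f x).
Proof. by move=> lf c x y; rewrite lf (bilin_tens V W).2. Qed.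

Lemma linear_mull U (A : algType k) (f : U -> A) (a : A) :
  linear f -> linear (fun x => f x * a).
Proof. by move=> lf c x y; rewrite lf mulrDl scalerAl. Qed.

Lemma linear_mulr U (A : algType k) (f : U -> A) (a : A) :
  linear f -> linear (fun x => a * f x).
Proof. by move=> lf c x y; rewrite lf mulrDr scalerAr. Qed.

Lemma linear_sweedler_arg U V W X (f : U -> V ⨂ W) (F : V -> W -> X) :
  linear f -> bilin F -> linear (fun x => sweedler (f x) F).
Proof. by move=> lf bF c x y; rewrite lf (sweedler_linear bF). Qed.

Lemma linear_sweedler_body U V W X (t : V ⨂ W) (F : U -> V -> W -> X) :
  (forall u v, linear (fun x => F x u v)) ->
  linear (fun x => sweedler t (F x)).
Proof.
move=> lF c x y; rewrite /sweedler /formal_sum scaler_sumr -big_split /=.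
by apply: eq_bigr => p _; apply: lF.
Qed.

Lemma tens_sum V W (t : V ⨂ W) : t = \sw_(x, y <- t) x ⊗ y.
Proof.
apply: tensorP => U f bf.
rewrite (linear_app _ _ (sweedler_linear bf)).
by apply: eq_sweedler => x y; rewrite sweedler_tens.
Qed.

Lemma tens_ind V W U (f g : V ⨂ W -> U) :
  linear f -> linear g -> (forall v w, f (v ⊗ w) = g (v ⊗ w)) -> f =1 g.
Proof.
move=> lf lg fg t; rewrite [t]tens_sum !linear_app //.
exact: eq_sweedler.
Qed.

Import classical_sets.
Local Open Scope classical_set_scope.

Lemma exists_functional V (v : V) :
  v != 0 -> exists2 f : V -> k^o, linear f & f v != 0.
Proof.
move=> v0.
pose P (S : set V) := (forall a u w, S u -> S w -> S (a *: u + w)) /\ ~ S v.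
have [|S [[Slin Sv] Smax]] := @Zorn_bigcup V P.
  move=> F FP Ftot; split; last by move=> [X FX Xv]; case: (FP _ FX).
  move=> a u w [X FX Xu] [Y FY Yw].
  have [XY|YX] := Ftot _ _ FX FY.
    by exists Y => //; apply: (FP _ FY).1 => //; apply: XY.
  by exists X => //; apply: (FP _ FX).1 => //; apply: YX.
pose S0 u := S u \/ u = 0.
have S0lin a u w : S0 u -> S0 w -> S0 (a *: u + w).
  move=> [Su|->] [Sw|->].
  - by left; apply: Slin.
  - left; rewrite addr0 -[X in S X]addr0.
    have Suu : S 0 by have := Slin (-1) _ _ Su Su; rewrite scaleN1r addNr.
    exact: Slin.
  - by left; rewrite scaler0 add0r.
  - by right; rewrite scaler0 add0r.
have S0v c : S0 (c *: v) -> c = 0.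
  move=> S0cv; apply/eqP; apply: contrapT => /negP c0.
  have : S0 v.
    have := S0lin c^-1 _ 0 S0cv (or_intror erefl).
    by rewrite addr0 scalerA mulVf // scale1r.
  by move=> [//|/eqP]; rewrite (negbTE v0).
have ex x : exists c, S0 (x - c *: v).
  have [S0x|nS0x] := pselect (S0 x); first by exists 0; rewrite scale0r subr0.
  pose B : set V := [set y | exists s c, S0 s /\ y = s + c *: x].
  have SB : S `<` B.
    split=> [s Ss|BS].
      by exists s, 0; split; [left|rewrite scale0r addr0].
    by apply: nS0x; left; apply: BS; exists 0, 1; split; [right|rewrite scale1r add0r].
  have [|Bv] := pselect (B v); last first.
    exfalso; apply: (Smax _ SB); split=> // a u w [s [c [S0s ->]]] [s' [c' [S0s' ->]]].
    exists (a *: s + s'), (a * c + c'); split; first exact: S0lin.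
    by rewrite scalerDr scalerA scalerDl addrACA.
  move=> [s [c [S0s vE]]].
  have c0 : c != 0.
    apply/eqP => c0; have S0v' : S0 v by rewrite vE c0 scale0r addr0.
    by move: S0v' => [//|/eqP]; rewrite (negbTE v0).
  exists c^-1; have := S0lin (- c^-1) _ 0 S0s (or_intror erefl).
  by rewrite {1}vE addr0 scalerDr scalerA mulVf // scale1r opprD addrCA subrr addr0 scaleNr.
have [f fP] := choice ex.
have fE x c : S0 (x - c *: v) -> f x = c.
  move=> xc; apply/eqP; rewrite -subr_eq0; apply/eqP/S0v.
  have := S0lin (-1) _ _ (fP x) xc.
  by rewrite scaleN1r opprB addrA subrK scalerBl.
exists f.
  move=> a x y; apply: fE.
  have := S0lin a _ _ (fP x) (fP y).
  by rewrite scalerBr scalerA addrACA -opprD -scalerDl.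
by rewrite (@fE v 1) ?oner_neq0 // scale1r subrr; right.
Qed.

Lemma tens_neq0 V W (v : V) (w : W) : v != 0 -> w != 0 -> v ⊗ w != 0.
Proof.
move=> /exists_functional[f lf fv] /exists_functional[g lg gw].
apply/eqP => vw0.
have bfg : bilin (fun x y => f x * g y : k^o).
  split=> z c x y /=; first by rewrite lf mulrDl scalerAl.
  by rewrite lg mulrDr scalerAr.
have := sweedler_tens v w bfg; rewrite vw0 (linear_zero (sweedler_linear bfg)).
by move/esym/eqP; rewrite mulf_eq0 (negbTE fv) (negbTE gw).
Qed.

End TensorTheory.

(* Linearity of a Sweedler expression in one of its variables. *)
Ltac lin_step :=
  cbv beta;
  lazymatch goal with
  | |- bilin _ => split; intro
  | |- GRing.linear_for _ (fun x => x) => exact: linear_idfun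
  | |- GRing.linear_for _ (tens _) => refine (linear_tensr _ _)
  | |- GRing.linear_for _ (GRing.mul _) => refine (linear_mulr _ _)
  | |- GRing.linear_for _ (fun x => tens _ _) =>
      first [refine (linear_tensl _ _) | refine (linear_tensr _ _)]
  | |- GRing.linear_for _ (fun x => GRing.mul _ _) =>
      first [refine (linear_mull _ _) | refine (linear_mulr _ _)]
  | |- GRing.linear_for _ (fun x => sweedler (@?f x) (@?F x)) =>
      lazymatch f with
      | fun _ => ?t =>
          refine (@linear_sweedler_body _ _ _ _ _ t F _); intros ? ?
      | _ => refine (@linear_sweedler_arg _ _ _ _ _ f _ _ _)
      end
  | |- GRing.linear_for _ _ => refine (linear_comp _ _)
  end.
Ltac lin := solve [repeat lin_step].

Section MultilinearTransfer.
Variable k : fieldType.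
Variables X Y Z U : lmodType k.
Variable G : X -> Y -> Z -> U.
Hypothesis lx : forall y z, linear (fun x => G x y z).
Hypothesis ly : forall x z, linear (fun y => G x y z).
Hypothesis lz : forall x y, linear (fun z => G x y z).

Definition lift3 (t : X ⨂ Y ⨂ Z) : U :=
  \sw_(xy, z <- t) \sw_(x, y <- xy) G x y z.

Lemma bilin_lift3 : bilin (fun xy z => \sw_(x, y <- xy) G x y z).
Proof.
split=> [z|xy].
  by apply: sweedler_linear; split=> [y|x]; [apply: lx|apply: ly].
by apply: linear_sweedler_body => x y; apply: lz.
Qed.

Lemma lift3_linear : linear lift3.
Proof. exact: sweedler_linear bilin_lift3. Qed.

Lemma lift3_tens x y z : lift3 (x ⊗ y ⊗ z) = G x y z.
Proof. by rewrite /lift3 (sweedler_tens _ _ bilin_lift3) sweedler_tens. Qed.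

Lemma lift3_sweedler2 (V W V' W' : lmodType k) (t : V ⨂ W) (s : V -> W -> V' ⨂ W') f g h :
  lift3 (\sw_(x, y <- t) \sw_(u, v <- s x y) f x y u v ⊗ g x y u v ⊗ h x y u v) =
  \sw_(x, y <- t) \sw_(u, v <- s x y) G (f x y u v) (g x y u v) (h x y u v).
Proof.
rewrite (linear_app _ _ lift3_linear); apply: eq_sweedler => x y.
rewrite (linear_app _ _ lift3_linear); apply: eq_sweedler => u v.
exact: lift3_tens.
Qed.
End MultilinearTransfer.

Lemma sweedler_sweedler2 (k : fieldType) (V W V' W' X Y U : lmodType k)
    (t : V ⨂ W) (s : V -> W -> V' ⨂ W') f g (G : X -> Y -> U) :
  bilin G ->
  sweedler (\sw_(x, y <- t) \sw_(u, v <- s x y) f x y u v ⊗ g x y u v) G =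
  \sw_(x, y <- t) \sw_(u, v <- s x y) G (f x y u v) (g x y u v).
Proof.
move=> bG; rewrite (linear_app _ _ (sweedler_linear bG)); apply: eq_sweedler => x y.
rewrite (linear_app _ _ (sweedler_linear bG)); apply: eq_sweedler => u v.
exact: sweedler_tens.
Qed.

(* In the names bound by [\sw], xR, xQ mark the results of R and Q (a second
   application is marked by r or q), and x0, x1 or xm, x0 the two components of
   a coaction on x (m stands for the component in B indexed by a negative
   integer). *)
Record LR_twisting (k : fieldType) (A B : algType k)
    (R : {linear B ⨂ A -> A ⨂ B}) (Q : {linear A ⨂ B -> A ⨂ B}) : Prop := {
  twR1l : forall a, R (1 ⊗ a) = a ⊗ 1;
  twR1r : forall b, R (b ⊗ 1) = 1 ⊗ b;
  twRMr : forall a a' b, R (b ⊗ (a * a')) =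
    \sw_(aR, bR <- R (b ⊗ a)) \sw_(a'r, bRr <- R (bR ⊗ a'))
      (aR * a'r) ⊗ bRr;
  twRMl : forall a b b', R ((b * b') ⊗ a) =
    \sw_(aR, b'R <- R (b' ⊗ a)) \sw_(aRr, br <- R (b ⊗ aR))
      aRr ⊗ (br * b'R);
  twQ1r : forall a, Q (a ⊗ 1) = a ⊗ 1;
  twQ1l : forall b, Q (1 ⊗ b) = 1 ⊗ b;
  twQMl : forall a a' b, Q ((a * a') ⊗ b) =
    \sw_(a'Q, bQ <- Q (a' ⊗ b)) \sw_(aq, bQq <- Q (a ⊗ bQ))
      (aq * a'Q) ⊗ bQq;
  twQMr : forall a b b', Q (a ⊗ (b * b')) =
    \sw_(aQ, bQ <- Q (a ⊗ b)) \sw_(aQq, b'q <- Q (aQ ⊗ b'))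
      aQq ⊗ (bQ * b'q);
  twRQA : forall a b b',
    \sw_(aR, bR <- R (b ⊗ a)) \sw_(aRQ, b'Q <- Q (aR ⊗ b')) bR ⊗ aRQ ⊗ b'Q =
    \sw_(aQ, b'Q <- Q (a ⊗ b')) \sw_(aQR, bR <- R (b ⊗ aQ)) bR ⊗ aQR ⊗ b'Q;
  twRQB : forall a a' b,
    \sw_(aR, bR <- R (b ⊗ a)) \sw_(a'Q, bRQ <- Q (a' ⊗ bR)) aR ⊗ bRQ ⊗ a'Q =
    \sw_(a'Q, bQ <- Q (a' ⊗ b)) \sw_(aR, bQR <- R (bQ ⊗ a)) aR ⊗ bQR ⊗ a'Q
}.

(* The algebra A _Q⊗_R B: the vector space A ⨂ B with the multiplication
   (a ⊗ b)(a' ⊗ b') = a_Q a'_R ⊗ b_R b'_Q. *)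
Section LRAlgebra.
Variables (k : fieldType) (A B : algType k).
Variables (R : {linear B ⨂ A -> A ⨂ B}) (Q : {linear A ⨂ B -> A ⨂ B}).

Definition LRmul (t t' : A ⨂ B) : A ⨂ B :=
  \sw_(a, b <- t) \sw_(a', b' <- t')
    \sw_(aQ, b'Q <- Q (a ⊗ b')) \sw_(a'R, bR <- R (b ⊗ a'))
      (aQ * a'R) ⊗ (bR * b'Q).

Definition LRalg (RQ : LR_twisting R Q) : Type := A ⨂ B.

Lemma LRmul_linearl t' : linear (fun t => LRmul t t').
Proof. by rewrite /LRmul; lin. Qed.

Lemma LRmul_linearr t : linear (LRmul t).
Proof. by rewrite /LRmul; lin. Qed.

Lemma LRmul_tens a b a' b' : LRmul (a ⊗ b) (a' ⊗ b') =
  \sw_(aQ, b'Q <- Q (a ⊗ b')) \sw_(a'R, bR <- R (b ⊗ a'))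
    (aQ * a'R) ⊗ (bR * b'Q).
Proof. by rewrite /LRmul !sweedler_tens //; lin. Qed.

Lemma linear_compose (U V W : lmodType k) (g : V -> W) (f : U -> V) :
  linear g -> linear f -> linear (fun x => g (f x)).
Proof. by move=> lg lf c x y; rewrite lf lg. Qed.

Hypothesis RQ : LR_twisting R Q.

Lemma LRmulA : associative LRmul.
Proof.
move=> x y z; move: x; apply: tens_ind => [||a b].
- exact: LRmul_linearl.
- by apply: linear_compose (LRmul_linearl _) (LRmul_linearl _).
move: y; apply: tens_ind => [||a' b'].
- by apply: linear_compose (LRmul_linearr _) (LRmul_linearl _).
- by apply: linear_compose (LRmul_linearl _) (LRmul_linearr _).
move: z; apply: tens_ind => [||a'' b''].
- by apply: linear_compose (LRmul_linearr _) (LRmul_linearr _).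
- exact: LRmul_linearr.
rewrite !LRmul_tens.
rewrite (linear_app _ _ (LRmul_linearr _)).
under eq_sweedler => a'Q b''Q.
  rewrite (linear_app _ _ (LRmul_linearr _)).
  under eq_sweedler => a''R b'R.
    rewrite LRmul_tens (twQMr RQ) sweedler_sweedler2; last by lin.
    under eq_sweedler => aQ b'RQ.
      under eq_sweedler => aQq b''Qq do
        [rewrite (twRMr RQ) sweedler_sweedler2; last by lin].
    over.
  over.
over.
rewrite [RHS](linear_app _ _ (LRmul_linearl _)).
under [RHS]eq_sweedler => aQ b'Q.
  rewrite (linear_app _ _ (LRmul_linearl _)).
  under eq_sweedler => a'R bR.
    rewrite LRmul_tens (twQMl RQ) sweedler_sweedler2; last by lin.
    under eq_sweedler => a'RQ b''Q.
      under eq_sweedler => aQq b''Qq do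
        [rewrite (twRMl RQ) sweedler_sweedler2; last by lin].
    over.
  over.
over.
pose H bR c b''Q a''R b'' aQ : A ⨂ B :=
  \sw_(aQq, b''Qq <- Q (aQ ⊗ b''Q)) \sw_(u, v <- R (bR ⊗ a''R))
    (aQq * c * u) ⊗ (v * b'' * b''Qq).
pose G bR c b''Q :=
  \sw_(aQ, b'Q <- Q (a ⊗ b')) \sw_(a''R, b'QR <- R (b'Q ⊗ a''))
    H bR c b''Q a''R b'QR aQ.
pose G' bR c b''Q :=
  \sw_(a''R, b'R <- R (b' ⊗ a'')) \sw_(aQ, b'RQ <- Q (a ⊗ b'R))
    H bR c b''Q a''R b'RQ aQ.
have GG' bR c b''Q : G bR c b''Q = G' bR c b''Q.
  have := congr1 (lift3 (H bR c b''Q)) (twRQB RQ a'' a b').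
  rewrite !lift3_sweedler2; [|by move=> *; rewrite /H; lin..].
  exact: esym.
have := congr1 (lift3 G) (twRQA RQ a' b b'').
rewrite !lift3_sweedler2; [|by move=> *; rewrite /G /H; lin..].
move=> E.
transitivity (\sw_(aQ, b'Q <- Q (a' ⊗ b'')) \sw_(aQR, bR <- R (b ⊗ aQ)) G bR aQR b'Q).
  apply: eq_sweedler => a'Q b''Q.
  under [RHS]eq_sweedler do rewrite GG' /G'.
  rewrite [RHS]exchange_sweedler; apply: eq_sweedler => a''R b'R.
  rewrite [RHS]exchange_sweedler; apply: eq_sweedler => aQ b'RQ.
  rewrite /H [RHS]exchange_sweedler; apply: eq_sweedler => aQq b''Qq.
  apply: eq_sweedler => x y; apply: eq_sweedler => u v.
  by rewrite !mulrA.
rewrite -E /G /H [RHS]exchange_sweedler.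
under [RHS]eq_sweedler do rewrite exchange_sweedler.
do 3 (apply: eq_sweedler => ? ?).
by rewrite exchange_sweedler.
Qed.

Lemma LRmul1 : left_id (1 ⊗ 1) LRmul.
Proof.
apply: tens_ind => [||a b]; [exact: LRmul_linearr|exact: linear_idfun|].
rewrite LRmul_tens (twQ1l RQ) (twR1l RQ) sweedler_tens; last by lin.
by rewrite sweedler_tens ?mul1r //; lin.
Qed.

Lemma LRmulr1 : right_id (1 ⊗ 1) LRmul.
Proof.
apply: tens_ind => [||a b]; [exact: LRmul_linearl|exact: linear_idfun|].
rewrite LRmul_tens (twQ1r RQ) (twR1r RQ) sweedler_tens; last by lin.
by rewrite sweedler_tens ?mulr1 //; lin.
Qed.

Lemma LRmulDl : left_distributive LRmul +%R.
Proof. by move=> x y z; have := LRmul_linearl z 1 x y; rewrite /= !scale1r. Qed.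

Lemma LRmulDr : right_distributive LRmul +%R.
Proof. by move=> x y z; have := LRmul_linearr x 1 y z; rewrite /= !scale1r. Qed.

Lemma LR_one_neq0 : (1 : A) ⊗ (1 : B) != 0.
Proof. by rewrite tens_neq0 ?oner_neq0. Qed.

Lemma LRmul_scalel c x y : c *: LRmul x y = LRmul (c *: x) y.
Proof.
have := LRmul_linearl y c x 0.
by rewrite /= (linear_zero (LRmul_linearl y)) !addr0.
Qed.

Lemma LRmul_scaler c x y : c *: LRmul x y = LRmul x (c *: y).
Proof.
have := LRmul_linearr x c y 0.
by rewrite /= (linear_zero (LRmul_linearr x)) !addr0.
Qed.

HB.instance Definition _ := GRing.Lmodule.copy (LRalg RQ) (A ⨂ B).
HB.instance Definition _ := GRing.Zmodule_isNzRing.Build (LRalg RQ)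
  LRmulA LRmul1 LRmulr1 LRmulDl LRmulDr LR_one_neq0.
HB.instance Definition _ := GRing.Lmodule_isLalgebra.Build k (LRalg RQ)
  LRmul_scalel.
HB.instance Definition _ := GRing.Lalgebra_isAlgebra.Build k (LRalg RQ)
  LRmul_scaler.

End LRAlgebra.

Section Bullet.
Variables (k : fieldType) (A B : algType k).
Variables (R : {linear B ⨂ A -> A ⨂ B}) (Q : {linear A ⨂ B -> A ⨂ B}).
Variables (mu_l : {linear B ⨂ A -> A}) (mu_r : {linear A ⨂ B -> A}).
Variables (rho_r : {linear A -> A ⨂ B}) (rho_l : {linear A -> B ⨂ A}).

Local Notation "b ▷ a" := (mu_l (b ⊗ a)) (at level 43, no associativity).
Local Notation "a ◁ b" := (mu_r (a ⊗ b)) (at level 43, no associativity).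

Definition bullet (a a' : A) : A :=
  \sw_(a0, a1 <- rho_r a) \sw_(a'm, a'0 <- rho_l a')
    (a0 ◁ a'm) * (a1 ▷ a'0).

Record bullet_axioms : Prop := {
  rho_r1 : rho_r 1 = 1 ⊗ 1;
  rho_l1 : rho_l 1 = 1 ⊗ 1;
  mu_l1 : forall a, 1 ▷ a = a;
  mu_r1 : forall a, a ◁ 1 = a;
  rho_r_mu_l1 : forall a, \sw_(a0, a1 <- rho_r a) a0 * (a1 ▷ 1) = a;
  rho_l_mu_r1 : forall a, \sw_(am, a0 <- rho_l a) (1 ◁ am) * a0 = a;
  mu_l_rho_r : forall a a' b,
    b ▷ (\sw_(a0, a1 <- rho_r a) a0 * (a1 ▷ a')) =
    \sw_(a0, a1 <- rho_r a) \sw_(a0R, bR <- R (b ⊗ a0))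
      a0R * (bR * a1 ▷ a');
  mu_r_rho_l : forall a a' b,
    (\sw_(a'm, a'0 <- rho_l a') (a ◁ a'm) * a'0) ◁ b =
    \sw_(a'm, a'0 <- rho_l a') \sw_(a'0Q, bQ <- Q (a'0 ⊗ b))
      (a ◁ a'm * bQ) * a'0Q;
  rho_r_bullet : forall a a', rho_r (bullet a a') =
    \sw_(a0, a1 <- rho_r a) \sw_(a'0, a'1 <- rho_r a')
      \sw_(a'0R, a1R <- R (a1 ⊗ a'0)) \sw_(a'0Rm, a'0R0 <- rho_l a'0R)
        (a0 ◁ a'0Rm) * a'0R0 ⊗ a1R * a'1;
  rho_l_bullet : forall a a', rho_l (bullet a a') =
    \sw_(am, a0 <- rho_l a) \sw_(a'm, a'0 <- rho_l a')
      \sw_(a0Q, a'mQ <- Q (a0 ⊗ a'm)) \sw_(a0Q0, a0Q1 <- rho_r a0Q)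
        am * a'mQ ⊗ a0Q0 * (a0Q1 ▷ a'0);
  rho_r_rho_l : forall a,
    \sw_(a0, a1 <- rho_r a) \sw_(a0m, a00 <- rho_l a0) a0m ⊗ a00 ⊗ a1 =
    \sw_(am, a0 <- rho_l a) \sw_(a00, a01 <- rho_r a0) am ⊗ a00 ⊗ a01;
  Q_rho_r : forall a b,
    \sw_(aQ, bQ <- Q (a ⊗ b)) \sw_(aQ0, aQ1 <- rho_r aQ) aQ0 ⊗ aQ1 ⊗ bQ =
    \sw_(a0, a1 <- rho_r a) \sw_(a0Q, bQ <- Q (a0 ⊗ b)) a0Q ⊗ a1 ⊗ bQ;
  R_rho_l : forall a b,
    \sw_(aR, bR <- R (b ⊗ a)) \sw_(aRm, aR0 <- rho_l aR) aRm ⊗ aR0 ⊗ bR =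
    \sw_(am, a0 <- rho_l a) \sw_(a0R, bR <- R (b ⊗ a0)) am ⊗ a0R ⊗ bR
}.

Lemma bullet_linearl a' : linear (fun a => bullet a a').
Proof. by rewrite /bullet; lin. Qed.

Lemma bullet_linearr a : linear (bullet a).
Proof. by rewrite /bullet; lin. Qed.

Hypothesis RQ : LR_twisting R Q.
Hypothesis bA : bullet_axioms.

Lemma bullet1 : left_id 1 bullet.
Proof.
move=> a; rewrite /bullet (rho_r1 bA) sweedler_tens; last by lin.
by under eq_sweedler do rewrite (mu_l1 bA); exact: rho_l_mu_r1 bA a.
Qed.

Lemma bulletr1 : right_id 1 bullet.
Proof.
move=> a; rewrite /bullet (rho_l1 bA).
under eq_sweedler do [rewrite sweedler_tens; last by lin].
by under eq_sweedler do rewrite (mu_r1 bA); exact: rho_r_mu_l1 bA a.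
Qed.

Lemma sweedler_sweedler4 (V1 W1 V2 W2 V3 W3 V4 W4 X Y U : lmodType k)
    (t1 : V1 ⨂ W1) (t2 : V2 ⨂ W2)
    (t3 : V1 -> W1 -> V2 -> W2 -> V3 ⨂ W3) (t4 : V3 -> V4 ⨂ W4)
    f g (G : X -> Y -> U) :
  bilin G ->
  sweedler (\sw_(x1, y1 <- t1) \sw_(x2, y2 <- t2)
    \sw_(x3, y3 <- t3 x1 y1 x2 y2) \sw_(x4, y4 <- t4 x3)
      f x1 y1 x2 y2 x3 y3 x4 y4 ⊗ g x1 y1 x2 y2 x3 y3 x4 y4) G =
  \sw_(x1, y1 <- t1) \sw_(x2, y2 <- t2)
    \sw_(x3, y3 <- t3 x1 y1 x2 y2) \sw_(x4, y4 <- t4 x3)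
      G (f x1 y1 x2 y2 x3 y3 x4 y4) (g x1 y1 x2 y2 x3 y3 x4 y4).
Proof.
move=> bG; have lG := sweedler_linear bG.
rewrite (linear_app _ _ lG); apply: eq_sweedler => x1 y1.
rewrite (linear_app _ _ lG); apply: eq_sweedler => x2 y2.
rewrite (linear_app _ _ lG); apply: eq_sweedler => x3 y3.
rewrite (linear_app _ _ lG); apply: eq_sweedler => x4 y4.
exact: sweedler_tens.
Qed.

Lemma bulletA : associative bullet.
Proof.
move=> a a' a''.
rewrite [LHS]/bullet (rho_l_bullet bA).
under eq_sweedler do
  [rewrite sweedler_sweedler4; last by lin].
rewrite [RHS]/bullet (rho_r_bullet bA) sweedler_sweedler4; last by lin.
apply: eq_sweedler => a0 a1.
pose F m y y2 cQ zR d : A := (a0 ◁ m * cQ) * (zR * (y * y2 ▷ d)).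
pose K m z y2 : A := \sw_(c, d <- rho_l a'')
  \sw_(zR, y <- R (a1 ⊗ z)) \sw_(zRQ, cQ <- Q (zR ⊗ c)) F m y y2 cQ zRQ d.
transitivity (\sw_(a'm, a'0 <- rho_l a') \sw_(z, y2 <- rho_r a'0) K a'm z y2).
  apply: eq_sweedler => m w.
  rewrite /K [RHS]exchange_sweedler; apply: eq_sweedler => c d.
  under [RHS]eq_sweedler => z y2.
    have := congr1 (lift3 (fun y zRQ cQ => F m y y2 cQ zRQ d))
      (twRQA RQ z a1 c).
    rewrite !lift3_sweedler2; [|by move=> *; rewrite /F; lin..].
    move=> ->; over.
  pose G q0 q1 cQ := \sw_(q0R, y <- R (a1 ⊗ q0)) F m y q1 cQ q0R d.
  have := congr1 (lift3 G) (Q_rho_r bA w c).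
  rewrite !lift3_sweedler2; [|by move=> *; rewrite /G /F; lin..].
  rewrite {2}/G {1}/F => <-; apply: eq_sweedler => q cQ.
  rewrite -(linear_app (h := fun x => (a0 ◁ m * cQ) * (a1 ▷ x))); last by lin.
  rewrite (mu_l_rho_r bA) (linear_app (h := fun x => (a0 ◁ m * cQ) * x)); last by lin.
  apply: eq_sweedler => q0 q1.
  by rewrite (linear_app (h := fun x => (a0 ◁ m * cQ) * x)) //; lin.
have := congr1 (lift3 K) (rho_r_rho_l bA a').
rewrite !lift3_sweedler2; [|by move=> *; rewrite /K /F; lin..].
move=> <-; apply: eq_sweedler => x2 y2.
pose G m z y := \sw_(c, d <- rho_l a'') \sw_(zQ, cQ <- Q (z ⊗ c))
  F m y y2 cQ zQ d.
have := congr1 (lift3 G) (R_rho_l bA x2 a1).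
rewrite !lift3_sweedler2; [|by move=> *; rewrite /G /F; lin..].
move=> E; transitivity (\sw_(m, z <- rho_l x2) \sw_(zR, y <- R (a1 ⊗ z)) G m zR y).
  by rewrite /K /G; apply: eq_sweedler => m z; rewrite exchange_sweedler.
rewrite -E; apply: eq_sweedler => x3 y3.
rewrite /G exchange_sweedler [RHS]exchange_sweedler; apply: eq_sweedler => c d.
rewrite -(linear_app (h := fun x => (x ◁ c) * (y3 * y2 ▷ d))); last by lin.
rewrite (mu_r_rho_l bA) (linear_app (h := fun x => x * (y3 * y2 ▷ d))); last by lin.
apply: eq_sweedler => m z.
rewrite (linear_app (h := fun x => x * (y3 * y2 ▷ d))); last by lin.
by apply: eq_sweedler => zQ cQ; rewrite /F mulrA.
Qed.

Lemma bulletDl : left_distributive bullet +%R.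
Proof. by move=> x y z; have := bullet_linearl z 1 x y; rewrite /= !scale1r. Qed.

Lemma bulletDr : right_distributive bullet +%R.
Proof. by move=> x y z; have := bullet_linearr x 1 y z; rewrite /= !scale1r. Qed.

Lemma bullet_scalel c x y : c *: bullet x y = bullet (c *: x) y.
Proof.
have := bullet_linearl y c x 0.
by rewrite /= (linear_zero (bullet_linearl y)) !addr0.
Qed.

Lemma bullet_scaler c x y : c *: bullet x y = bullet x (c *: y).
Proof.
have := bullet_linearr x c y 0.
by rewrite /= (linear_zero (bullet_linearr x)) !addr0.
Qed.

(* The vector space A with the multiplication [bullet] and the unit 1. *)
Definition tildeA (_ : LR_twisting R Q) (_ : bullet_axioms) : Type := A.

HB.instance Definition _ := GRing.Lmodule.copy (tildeA RQ bA) A.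
HB.instance Definition _ := GRing.Zmodule_isNzRing.Build (tildeA RQ bA)
  bulletA bullet1 bulletr1 bulletDl bulletDr (oner_neq0 A).
HB.instance Definition _ := GRing.Lmodule_isLalgebra.Build k (tildeA RQ bA)
  bullet_scalel.
HB.instance Definition _ := GRing.Lalgebra_isAlgebra.Build k (tildeA RQ bA)
  bullet_scaler.

Variables (lam_r : {linear A -> A ⨂ B}) (lam_l : {linear A -> B ⨂ A}).

Record lambda_axioms : Prop := {
  lam_r1 : lam_r 1 = 1 ⊗ 1;
  lam_l1 : lam_l 1 = 1 ⊗ 1;
  rho_r_lam_r : forall a,
    \sw_(a0, a1 <- rho_r a) \sw_(x, y <- lam_r a0) x ⊗ y * a1 = a ⊗ 1;
  lam_r_rho_r : forall a,
    \sw_(x, y <- lam_r a) \sw_(x0, x1 <- rho_r x) x0 ⊗ x1 * y = a ⊗ 1;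
  rho_l_lam_l : forall a,
    \sw_(am, a0 <- rho_l a) \sw_(n, z <- lam_l a0) am * n ⊗ z = 1 ⊗ a;
  lam_l_rho_l : forall a,
    \sw_(n, z <- lam_l a) \sw_(zm, z0 <- rho_l z) n * zm ⊗ z0 = 1 ⊗ a;
  lam_r_lam_l : forall a,
    \sw_(x, y <- lam_r a) \sw_(n, z <- lam_l x) n ⊗ z ⊗ y =
    \sw_(n, z <- lam_l a) \sw_(x, y <- lam_r z) n ⊗ x ⊗ y;
  lam_r_rho_l : forall a,
    \sw_(x, y <- lam_r a) \sw_(xm, x0 <- rho_l x) xm ⊗ x0 ⊗ y =
    \sw_(am, a0 <- rho_l a) \sw_(x, y <- lam_r a0) am ⊗ x ⊗ y;
  rho_r_lam_l : forall a,
    \sw_(a0, a1 <- rho_r a) \sw_(n, z <- lam_l a0) n ⊗ z ⊗ a1 =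
    \sw_(n, z <- lam_l a) \sw_(z0, z1 <- rho_r z) n ⊗ z0 ⊗ z1;
  lam_rM : forall a a', lam_r (a * a') =
    \sw_(x, y <- lam_r a) \sw_(x0, x1 <- rho_r x)
      \sw_(a'R, yR <- R (y ⊗ a')) \sw_(u, v <- lam_r a'R)
        x0 * (x1 ▷ u) ⊗ v * yR;
  lam_lM : forall a a', lam_l (a * a') =
    \sw_(n', z' <- lam_l a') \sw_(z'm, z'0 <- rho_l z')
      \sw_(aQ, n'Q <- Q (a ⊗ n')) \sw_(n, z <- lam_l aQ)
        n'Q * n ⊗ (z ◁ z'm) * z'0;
  rho_l_mu_r : forall a a',
    rho_l (\sw_(a'm, a'0 <- rho_l a') (a ◁ a'm) * a'0) =
    \sw_(am, a0 <- rho_l a) \sw_(a'm, a'0 <- rho_l a')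
      \sw_(a0Q, a'mQ <- Q (a0 ⊗ a'm)) am * a'mQ ⊗ a0Q * a'0;
  rho_RQ : forall a a',
    \sw_(a0, a1 <- rho_r a) \sw_(a0m, a00 <- rho_l a0)
      \sw_(a'0, a'1 <- rho_r a') \sw_(a'0m, a'00 <- rho_l a'0)
        \sw_(a'00R, a0mR <- R (a0m ⊗ a'00))
          \sw_(a00Q, a'1Q <- Q (a00 ⊗ a'1))
            a0mR * a'1Q ⊗ a00Q ⊗ a'00R ⊗ a'0m ⊗ a1 =
    \sw_(a0, a1 <- rho_r a) \sw_(a0m, a00 <- rho_l a0)
      \sw_(a'0, a'1 <- rho_r a') \sw_(a'0m, a'00 <- rho_l a'0)
        a'1 * a0m ⊗ a00 ⊗ a'00 ⊗ a'0m ⊗ a1;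
  lam_l_RQ : forall a a' b,
    \sw_(a0, a1 <- rho_r a) \sw_(a'm, a'0 <- rho_l a')
      \sw_(a'0Q, bQ <- Q (a'0 ⊗ b)) \sw_(n, z <- lam_l a'0Q)
        \sw_(a0R, nR <- R (n ⊗ a0))
          nR * a1 ⊗ z ⊗ a'm ⊗ a0R ⊗ bQ =
    \sw_(a0, a1 <- rho_r a) \sw_(a'm, a'0 <- rho_l a')
      \sw_(a'0Q, bQ <- Q (a'0 ⊗ b)) \sw_(a'0Qq, a1q <- Q (a'0Q ⊗ a1))
        \sw_(n, z <- lam_l a'0Qq)
          a1q * n ⊗ z ⊗ a'm ⊗ a0 ⊗ bQ;
  lam_r_RQ : forall a a' b,
    \sw_(a0, a1 <- rho_r a) \sw_(a'm, a'0 <- rho_l a')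
      \sw_(a0R, bR <- R (b ⊗ a0)) \sw_(x, y <- lam_r a0R)
        \sw_(a'0Q, yQ <- Q (a'0 ⊗ y))
          x ⊗ a'm * yQ ⊗ a'0Q ⊗ a1 ⊗ bR =
    \sw_(a0, a1 <- rho_r a) \sw_(a'm, a'0 <- rho_l a')
      \sw_(a0r, br <- R (b ⊗ a0)) \sw_(a0rR, a'mR <- R (a'm ⊗ a0r))
        \sw_(x, y <- lam_r a0rR)
          x ⊗ y * a'mR ⊗ a'0 ⊗ a1 ⊗ br;
  rho_r_R_lam_l_Q : forall a b b',
    \sw_(am, a0 <- rho_l a) \sw_(a0Q, b'Q <- Q (a0 ⊗ b'))
      \sw_(n, z <- lam_l a0Q) \sw_(z0, z1 <- rho_r z)
        \sw_(z0R, bR <- R (b ⊗ z0))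
          z0R ⊗ z1 ⊗ am ⊗ n ⊗ bR ⊗ b'Q =
    \sw_(a0, a1 <- rho_r a) \sw_(a0R, bR <- R (b ⊗ a0))
      \sw_(xm, x0 <- rho_l a0R) \sw_(x0Q, b'Q <- Q (x0 ⊗ b'))
        \sw_(n, z <- lam_l x0Q)
          z ⊗ a1 ⊗ xm ⊗ n ⊗ bR ⊗ b'Q;
  rho_l_Q_lam_r_R : forall a b b',
    \sw_(a0, a1 <- rho_r a) \sw_(a0R, bR <- R (b ⊗ a0))
      \sw_(x, y <- lam_r a0R) \sw_(xm, x0 <- rho_l x)
        \sw_(x0Q, b'Q <- Q (x0 ⊗ b'))
          y ⊗ x0Q ⊗ xm ⊗ a1 ⊗ bR ⊗ b'Q =
    \sw_(a0, a1 <- rho_r a) \sw_(a0m, a00 <- rho_l a0)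
      \sw_(a00R, bR <- R (b ⊗ a00)) \sw_(a00RQ, b'Q <- Q (a00R ⊗ b'))
        \sw_(x, y <- lam_r a00RQ)
          y ⊗ x ⊗ a0m ⊗ a1 ⊗ bR ⊗ b'Q;
  rho_r_lam_r_R_mu_r : forall a b b',
    \sw_(a0, a1 <- rho_r a) \sw_(cR, bR <- R (b ⊗ (a0 ◁ b')))
      \sw_(x, y <- lam_r cR) \sw_(x0, x1 <- rho_r x)
        x0 ⊗ x1 ⊗ y ⊗ bR ⊗ a1 =
    \sw_(a0, a1 <- rho_r a) \sw_(a0R, bR <- R (b ⊗ a0))
      \sw_(x, y <- lam_r a0R) \sw_(x0, x1 <- rho_r x)
        (x0 ◁ b') ⊗ x1 ⊗ y ⊗ bR ⊗ a1;
  rho_l_lam_l_Q_mu_l : forall a' b b',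
    \sw_(a'm, a'0 <- rho_l a') \sw_(cQ, b'Q <- Q ((b ▷ a'0) ⊗ b'))
      \sw_(n, z <- lam_l cQ) \sw_(zm, z0 <- rho_l z)
        a'm ⊗ n ⊗ zm ⊗ z0 ⊗ b'Q =
    \sw_(a'm, a'0 <- rho_l a') \sw_(a'0Q, b'Q <- Q (a'0 ⊗ b'))
      \sw_(n, z <- lam_l a'0Q) \sw_(zm, z0 <- rho_l z)
        a'm ⊗ n ⊗ zm ⊗ (b ▷ z0) ⊗ b'Q
}.

Definition Rtilde (t : B ⨂ tildeA RQ bA) : tildeA RQ bA ⨂ B :=
  \sw_(b, a <- t)
    \sw_(a0, a1 <- rho_r a) \sw_(a0R, bR <- R (b ⊗ a0))
      \sw_(x, y <- lam_r a0R)
        (x : tildeA RQ bA) ⊗ y * bR * a1.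

Definition Qtilde (t : tildeA RQ bA ⨂ B) : tildeA RQ bA ⨂ B :=
  \sw_(a, b <- t)
    \sw_(am, a0 <- rho_l a) \sw_(a0Q, bQ <- Q (a0 ⊗ b))
      \sw_(n, z <- lam_l a0Q)
        (z : tildeA RQ bA) ⊗ am * bQ * n.

Lemma Rtilde_linear : linear Rtilde.
Proof. by rewrite /Rtilde; lin. Qed.

Lemma Qtilde_linear : linear Qtilde.
Proof. by rewrite /Qtilde; lin. Qed.

HB.instance Definition _ :=
  GRing.isLinear.Build k (B ⨂ tildeA RQ bA) (tildeA RQ bA ⨂ B) *:%R Rtilde
    Rtilde_linear.
HB.instance Definition _ :=
  GRing.isLinear.Build k (tildeA RQ bA ⨂ B) (tildeA RQ bA ⨂ B) *:%R Qtilde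
    Qtilde_linear.

End Bullet.

Arguments Rtilde {k A B R Q mu_l mu_r rho_r rho_l} RQ bA lam_r t.
Arguments Qtilde {k A B R Q mu_l mu_r rho_r rho_l} RQ bA lam_l t.

(* Main.v *)
(* The map phi of the theorem is the composite of the commuting "translations"
   a ⊗ b |-> a_(0) ⊗ a_(1) b and a ⊗ b |-> a_<0> ⊗ b a_<-1>, which lam_r and lam_l
   invert.  Expanding rho_r and rho_l on a bullet product shows that phi is
   multiplicative for the product attached to the twisted maps, so this product is
   associative because the one of A _Q⊗_R B is.  Evaluating associativity on
   factors of the form a ⊗ 1 and 1 ⊗ b gives back the four multiplicativity axioms
   of an L-R-twisting; only the two compatibilities between the twisted maps
   require a separate computation. *)

From HB Require Import structures.
Require Import Defs.
From mathcomp Require Import all_boot all_order all_algebra.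

Set Implicit Arguments.
Unset Strict Implicit.
Unset Printing Implicit Defensive.

Import GRing.Theory.
Local Open Scope ring_scope.

(** * Iterated Sweedler sums: exchange, multilinear lifts, normalising tactics *)

Section SweedlerCalculus.
Variable k : fieldType.

Lemma sweedler_assoc (V W V' W' U : lmodType k) (t : V ⨂ W)
    (F : V -> W -> V' ⨂ W') (G : V' -> W' -> U) :
  bilin G ->
  sweedler (\sw_(x, y <- t) F x y) G = \sw_(x, y <- t) sweedler (F x y) G.
Proof. by move=> bG; rewrite (linear_app _ _ (sweedler_linear bG)). Qed.

(** [s] must not depend on [x] and [y]. The hypothesis moves [s] to the front of the body, so
    repeated application brings a summation out from any depth. *)
Lemma pull_sweedler (V W V' W' U : lmodType k) (t : V ⨂ W) (s : V' ⨂ W')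
    (F : V -> W -> U) (G : V' -> W' -> V -> W -> U) :
  (forall x y, F x y = \sw_(u, v <- s) G u v x y) ->
  \sw_(x, y <- t) F x y = \sw_(u, v <- s) \sw_(x, y <- t) G u v x y.
Proof. by move=> FG; rewrite (eq_sweedler _ FG) exchange_sweedler. Qed.

Section Lift5.
Variables (V1 V2 V3 V4 V5 U : lmodType k) (G : V1 -> V2 -> V3 -> V4 -> V5 -> U).
Hypothesis lin1 : forall x2 x3 x4 x5, linear (fun x1 => G x1 x2 x3 x4 x5).
Hypothesis lin2 : forall x1 x3 x4 x5, linear (fun x2 => G x1 x2 x3 x4 x5).
Hypothesis lin3 : forall x1 x2 x4 x5, linear (fun x3 => G x1 x2 x3 x4 x5).
Hypothesis lin4 : forall x1 x2 x3 x5, linear (fun x4 => G x1 x2 x3 x4 x5).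
Hypothesis lin5 : forall x1 x2 x3 x4, linear (fun x5 => G x1 x2 x3 x4 x5).

(** As [⨂] associates to the left, [V1 ⨂ V2 ⨂ V3] serves as the first of three factors. *)
Definition lift5 : V1 ⨂ V2 ⨂ V3 ⨂ V4 ⨂ V5 -> U :=
  lift3 (fun t x4 x5 => lift3 (fun x1 x2 x3 => G x1 x2 x3 x4 x5) t).

Let lint x4 x5 : linear (lift3 (fun x1 x2 x3 => G x1 x2 x3 x4 x5)).
Proof. exact: lift3_linear. Qed.

Let lin_lift4 t x5 :
  linear (fun x4 => lift3 (fun x1 x2 x3 => G x1 x2 x3 x4 x5) t).
Proof. by do 2 apply: linear_sweedler_body => ? ?. Qed.

Let lin_lift5 t x4 :
  linear (fun x5 => lift3 (fun x1 x2 x3 => G x1 x2 x3 x4 x5) t).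
Proof. by do 2 apply: linear_sweedler_body => ? ?. Qed.

Lemma lift5_linear : linear lift5. Proof. exact: lift3_linear. Qed.

Lemma lift5_tens x1 x2 x3 x4 x5 :
  lift5 (x1 ⊗ x2 ⊗ x3 ⊗ x4 ⊗ x5) = G x1 x2 x3 x4 x5.
Proof. by rewrite /lift5 !lift3_tens. Qed.
End Lift5.

Section Lift6.
Variables (V1 V2 V3 V4 V5 V6 U : lmodType k).
Variable G : V1 -> V2 -> V3 -> V4 -> V5 -> V6 -> U.
Hypothesis lin1 : forall x2 x3 x4 x5 x6, linear (fun x1 => G x1 x2 x3 x4 x5 x6).
Hypothesis lin2 : forall x1 x3 x4 x5 x6, linear (fun x2 => G x1 x2 x3 x4 x5 x6).
Hypothesis lin3 : forall x1 x2 x4 x5 x6, linear (fun x3 => G x1 x2 x3 x4 x5 x6).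
Hypothesis lin4 : forall x1 x2 x3 x5 x6, linear (fun x4 => G x1 x2 x3 x4 x5 x6).
Hypothesis lin5 : forall x1 x2 x3 x4 x6, linear (fun x5 => G x1 x2 x3 x4 x5 x6).
Hypothesis lin6 : forall x1 x2 x3 x4 x5, linear (fun x6 => G x1 x2 x3 x4 x5 x6).

Definition lift6 (t : V1 ⨂ V2 ⨂ V3 ⨂ V4 ⨂ V5 ⨂ V6) : U :=
  \sw_(t5, x6 <- t) lift5 (fun x1 x2 x3 x4 x5 => G x1 x2 x3 x4 x5 x6) t5.

Let bilin_lift6 : bilin (fun t x6 =>
  lift5 (fun x1 x2 x3 x4 x5 => G x1 x2 x3 x4 x5 x6) t).
Proof.
split=> [x6|t]; first exact: lift5_linear.
by do 4 apply: linear_sweedler_body => ? ?.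
Qed.

Lemma lift6_linear : linear lift6. Proof. exact: sweedler_linear. Qed.

Lemma lift6_tens x1 x2 x3 x4 x5 x6 :
  lift6 (x1 ⊗ x2 ⊗ x3 ⊗ x4 ⊗ x5 ⊗ x6) = G x1 x2 x3 x4 x5 x6.
Proof. by rewrite /lift6 sweedler_tens ?lift5_tens. Qed.
End Lift6.

End SweedlerCalculus.

(* Computes the flat form of the left-hand side; the right-hand side is an evar. *)
Ltac sw_flatten :=
  lazymatch goal with
  | |- sweedler (sweedler _ _) _ = _ =>
      etransitivity; [apply: sweedler_assoc; lin|cbv beta; sw_flatten]
  | |- sweedler (tens _ _) _ = _ =>
      etransitivity; [apply: sweedler_tens; lin|cbv beta; sw_flatten]
  | |- sweedler _ _ = _ =>
      apply: eq_sweedler; intros ? ?; cbv beta; sw_flatten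
  | |- _ => reflexivity
  end.

(* Comparing the factors separately ignores the implicit structures of [tens],
   where the paths from algType to lmodType may differ. *)
Ltac same_tensor s t :=
  first
  [ constr_eq s t
  | lazymatch s with
    | ?f (tens ?x ?y) =>
        lazymatch t with
        | ?g (tens ?u ?v) => constr_eq f g; constr_eq x u; constr_eq y v
        end
    end ].

(* Moves the summation over [t] to the front; the right-hand side is an evar. *)
Ltac sw_pull t :=
  lazymatch goal with
  | |- sweedler ?s _ = _ =>
      tryif same_tensor s t then reflexivity
      else (apply: pull_sweedler; intros ? ?; cbv beta; sw_pull t)
  end.

(** The left-hand side fixes the order of summation. What remains after matching all the sums
    differs only by bracketing and units. *)
Ltac sw_reorder :=
  cbv beta;
  lazymatch goal with
  | |- sweedler ?t _ = sweedler ?s _ =>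
      tryif same_tensor s t then (apply: eq_sweedler; intros ? ?; sw_reorder)
      else (etransitivity; [|symmetry; sw_pull t]; sw_reorder)
  | |- _ => by rewrite ?mulrA ?mul1r ?mulr1
  end.

Ltac sw_eq :=
  etransitivity; [sw_flatten|]; symmetry; etransitivity; [sw_flatten|];
  symmetry; sw_reorder.

Ltac sw_push L T :=
  cbv beta;
  lazymatch goal with
  | |- sweedler _ _ = _ => sw_flatten
  | |- _ (sweedler _ _) = _ =>
     etransitivity; [apply: (linear_app _ _ L)|];
     apply: eq_sweedler; intros ? ?; sw_push L T
  | |- _ => etransitivity; [apply: T|cbv beta; sw_flatten]
  end.

(* Here [h] is the linear lift of a multilinear map, with linearity proof [L] and
   value [T] on pure tensors; the goal is the image under [h] of the tensor
   identity [E], up to flattening and order of summation. *)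
Ltac sw_by L T h E :=
  etransitivity; [sw_flatten|]; symmetry; etransitivity; [sw_flatten|]; symmetry;
  etransitivity;
    [|etransitivity; [exact: (f_equal h E)|]];
    [symmetry; etransitivity; [sw_push L T|symmetry; sw_reorder]
    |etransitivity; [sw_push L T|sw_reorder]].

(* The head [sweedler] is flattened directly, hence the dummy arguments. *)
Ltac sw_by2 G E := sw_by tt tt (fun t => sweedler t G) E.

Ltac sw_by3 G E :=
  let L := fresh "L" in let T := fresh "T" in
  assert (L : linear (lift3 G))
    by (apply: lift3_linear; intros; lin);
  assert (T : forall x y z, lift3 G (x ⊗ y ⊗ z) = G x y z)
    by (intros; apply: lift3_tens; intros; lin);
  sw_by L T (lift3 G) E.

Ltac sw_by5 G E :=
  let L := fresh "L" in let T := fresh "T" in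
  assert (L : linear (lift5 G))
    by (apply: lift5_linear; intros; lin);
  assert (T : forall x y z u v, lift5 G (x ⊗ y ⊗ z ⊗ u ⊗ v) = G x y z u v)
    by (intros; apply: lift5_tens; intros; lin);
  sw_by L T (lift5 G) E.

Ltac sw_by6 G E :=
  let L := fresh "L" in let T := fresh "T" in
  assert (L : linear (lift6 G))
    by (apply: lift6_linear; intros; lin);
  assert (T : forall x y z u v w,
    lift6 G (x ⊗ y ⊗ z ⊗ u ⊗ v ⊗ w) = G x y z u v w)
    by (intros; apply: lift6_tens; intros; lin);
  sw_by L T (lift6 G) E.

(** * Recovering a twisting from associativity *)

(** By the unit conditions [R (b ⊗ a)] is the product of [1 ⊗ b] and [a ⊗ 1], [Q (a ⊗ b)] is that of
    [a ⊗ 1] and [1 ⊗ b], and [A ⊗ 1], [1 ⊗ B] multiply as [A], [B]. Each multiplicativity axiom then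
    computes one triple product with both bracketings. *)
Lemma LR_twisting_of_assoc (k : fieldType) (A B : algType k)
    (R : {linear B ⨂ A -> A ⨂ B}) (Q : {linear A ⨂ B -> A ⨂ B}) :
  (forall a, R (1 ⊗ a) = a ⊗ 1) -> (forall b, R (b ⊗ 1) = 1 ⊗ b) ->
  (forall a, Q (a ⊗ 1) = a ⊗ 1) -> (forall b, Q (1 ⊗ b) = 1 ⊗ b) ->
  (forall a b b',
    \sw_(aR, bR <- R (b ⊗ a)) \sw_(aRQ, b'Q <- Q (aR ⊗ b')) bR ⊗ aRQ ⊗ b'Q =
    \sw_(aQ, b'Q <- Q (a ⊗ b')) \sw_(aQR, bR <- R (b ⊗ aQ)) bR ⊗ aQR ⊗ b'Q) ->
  (forall a a' b,
    \sw_(aR, bR <- R (b ⊗ a)) \sw_(a'Q, bRQ <- Q (a' ⊗ bR)) aR ⊗ bRQ ⊗ a'Q =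
    \sw_(a'Q, bQ <- Q (a' ⊗ b)) \sw_(aR, bQR <- R (bQ ⊗ a)) aR ⊗ bQR ⊗ a'Q) ->
  associative (LRmul R Q) -> LR_twisting R Q.
Proof.
move=> R1l R1r Q1r Q1l RQA RQB mulA.
have Ra a b t : LRmul R Q (1 ⊗ b) (a ⊗ t) =
    \sw_(aR, bR <- R (b ⊗ a)) aR ⊗ (bR * t).
  rewrite LRmul_tens Q1l sweedler_tens; last by lin.
  by under eq_sweedler do rewrite mul1r.
have aR a a' b : LRmul R Q (a ⊗ b) (a' ⊗ 1) =
    \sw_(a'R, bR <- R (b ⊗ a')) (a * a'R) ⊗ bR.
  rewrite LRmul_tens Q1r sweedler_tens; last by lin.
  by under eq_sweedler do rewrite mulr1.
have aQ a b b' : LRmul R Q (a ⊗ b) (1 ⊗ b') =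
    \sw_(aQ, b'Q <- Q (a ⊗ b')) aQ ⊗ (b * b'Q).
  rewrite LRmul_tens; apply: eq_sweedler => x y.
  by rewrite R1r sweedler_tens ?mulr1 //; lin.
have Qa a a' b : LRmul R Q (a ⊗ 1) (a' ⊗ b) =
    \sw_(aQ, bQ <- Q (a ⊗ b)) (aQ * a') ⊗ bQ.
  rewrite LRmul_tens; apply: eq_sweedler => x y.
  by rewrite R1l sweedler_tens ?mul1r //; lin.
have RE a b : R (b ⊗ a) = LRmul R Q (1 ⊗ b) (a ⊗ 1).
  by rewrite aR [LHS]tens_sum; under [RHS]eq_sweedler do rewrite mul1r.
have QE a b : Q (a ⊗ b) = LRmul R Q (a ⊗ 1) (1 ⊗ b).
  by rewrite aQ [LHS]tens_sum; under [RHS]eq_sweedler do rewrite mul1r.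
have ll := @LRmul_linearl _ _ _ R Q; have lr := @LRmul_linearr _ _ _ R Q.
split=> //.
- move=> a a' b; transitivity (LRmul R Q (R (b ⊗ a)) (a' ⊗ 1)).
    rewrite !RE -mulA; congr LRmul.
    by rewrite aR R1l sweedler_tens //; lin.
  rewrite [X in LRmul _ _ X _]tens_sum (linear_app _ _ (ll _)).
  by apply: eq_sweedler => x y; rewrite aR.
- move=> a b b'; transitivity (LRmul R Q (1 ⊗ b) (R (b' ⊗ a))).
    rewrite !RE mulA; congr LRmul.
    by rewrite aQ Q1l sweedler_tens //; lin.
  rewrite [X in LRmul _ _ _ X]tens_sum (linear_app _ _ (lr _)).
  by apply: eq_sweedler => x y; rewrite Ra.
- move=> a a' b; transitivity (LRmul R Q (a ⊗ 1) (Q (a' ⊗ b))).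
    rewrite !QE mulA; congr LRmul.
    by rewrite aR R1l sweedler_tens //; lin.
  rewrite [X in LRmul _ _ _ X]tens_sum (linear_app _ _ (lr _)).
  by apply: eq_sweedler => x y; rewrite Qa.
- move=> a b b'; transitivity (LRmul R Q (Q (a ⊗ b)) (1 ⊗ b')).
    rewrite !QE -mulA; congr LRmul.
    by rewrite aQ Q1l sweedler_tens //; lin.
  rewrite [X in LRmul _ _ X _]tens_sum (linear_app _ _ (ll _)).
  by apply: eq_sweedler => x y; rewrite aQ.
Qed.

(** * Translations along a coaction *)

Section Shift.
Variables (k : fieldType) (V : lmodType k) (B : algType k).

Definition shiftr (f : V -> V ⨂ B) (t : V ⨂ B) : V ⨂ B :=
  \sw_(v, b <- t) \sw_(x, y <- f v) x ⊗ y * b.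

Definition shiftl (f : V -> B ⨂ V) (t : V ⨂ B) : V ⨂ B :=
  \sw_(v, b <- t) \sw_(y, x <- f v) x ⊗ b * y.

Lemma shiftr_linear (f : {linear V -> V ⨂ B}) : linear (shiftr f).
Proof. by rewrite /shiftr; lin. Qed.

Lemma shiftl_linear (f : {linear V -> B ⨂ V}) : linear (shiftl f).
Proof. by rewrite /shiftl; lin. Qed.

(** The hypothesis is the case [b = 1]; right multiplication of the second factor by [b] gives the
    general one. *)
Lemma shiftrK (f g : {linear V -> V ⨂ B}) :
  (forall v, \sw_(x, y <- f v) \sw_(x', y' <- g x) x' ⊗ y' * y = v ⊗ 1) ->
  cancel (shiftr f) (shiftr g).
Proof.
move=> fg; apply: tens_ind; [|by []|move=> v b].
  by apply: linear_compose; apply: shiftr_linear.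
transitivity (\sw_(w, c <- v ⊗ 1 : V ⨂ B) w ⊗ c * b); last first.
  by rewrite sweedler_tens ?mul1r //; lin.
by rewrite -fg /shiftr; sw_eq.
Qed.

Lemma shiftlK (f g : {linear V -> B ⨂ V}) :
  (forall v, \sw_(y, x <- f v) \sw_(y', x' <- g x) y * y' ⊗ x' = 1 ⊗ v) ->
  cancel (shiftl f) (shiftl g).
Proof.
move=> fg; apply: tens_ind; [|by []|move=> v b].
  by apply: linear_compose; apply: shiftl_linear.
transitivity (\sw_(c, w <- 1 ⊗ v : B ⨂ V) w ⊗ b * c); last first.
  by rewrite sweedler_tens ?mulr1 //; lin.
by rewrite -fg /shiftl; sw_eq.
Qed.
End Shift.

(** * The isomorphism on underlying spaces *)

Section Tilde.
Variables (k : fieldType) (A B : algType k).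
Variables (R : {linear B ⨂ A -> A ⨂ B}) (Q : {linear A ⨂ B -> A ⨂ B}).
Hypothesis RQ : LR_twisting R Q.
Variables (mu_l : {linear B ⨂ A -> A}) (mu_r : {linear A ⨂ B -> A}).
Variables (rho_r : {linear A -> A ⨂ B}) (rho_l : {linear A -> B ⨂ A}).
Hypothesis bA : bullet_axioms R Q mu_l mu_r rho_r rho_l.
Variables (lam_r : {linear A -> A ⨂ B}) (lam_l : {linear A -> B ⨂ A}).
Hypothesis lA : lambda_axioms R Q mu_l mu_r rho_r rho_l lam_r lam_l.

Local Notation "a ◁ b" := (mu_r (a ⊗ b)) (at level 43, no associativity).
Local Notation "a • b" := (bullet mu_l mu_r rho_r rho_l a b)
  (at level 40, left associativity).

(* [Rhat] and [Qhat] are the twisted maps [Rtilde] and [Qtilde] on pure tensors,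
   without the change of carrier from A to [tildeA]. *)
Definition Rhat (b : B) (a : A) : A ⨂ B :=
  \sw_(a0, a1 <- rho_r a) \sw_(a0R, bR <- R (b ⊗ a0))
    \sw_(x, y <- lam_r a0R) x ⊗ y * bR * a1.

Definition Qhat (a : A) (b : B) : A ⨂ B :=
  \sw_(am, a0 <- rho_l a) \sw_(a0Q, bQ <- Q (a0 ⊗ b))
    \sw_(n, z <- lam_l a0Q) z ⊗ am * bQ * n.

(** The isomorphism of the theorem, before the change of carrier. *)
Definition untilde (t : A ⨂ B) : A ⨂ B := shiftl rho_l (shiftr rho_r t).

Lemma untilde_linear : linear untilde.
Proof. by apply: linear_compose; [apply: shiftl_linear|apply: shiftr_linear]. Qed.

Lemma untilde_bij : bijective untilde.
Proof.
by apply: bij_comp; [exists (shiftl lam_l)|exists (shiftr lam_r)];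
  [apply: shiftlK (rho_l_lam_l lA)|apply: shiftlK (lam_l_rho_l lA)
  |apply: shiftrK (rho_r_lam_r lA)|apply: shiftrK (lam_r_rho_r lA)].
Qed.

Lemma untilde_tens a b : untilde (a ⊗ b) =
  \sw_(a0, a1 <- rho_r a) \sw_(am, a00 <- rho_l a0) a00 ⊗ a1 * b * am.
Proof. by rewrite /untilde /shiftl /shiftr; sw_eq. Qed.

(** * Unit conditions for the twisted maps *)

Lemma Rhat1l a : Rhat 1 a = a ⊗ 1.
Proof.
rewrite -(rho_r_lam_r lA a); apply: eq_sweedler => a0 a1.
rewrite (twR1l RQ) sweedler_tens; last by lin.
by under eq_sweedler do rewrite mulr1.
Qed.

Lemma Rhat1r b : Rhat b 1 = 1 ⊗ b.
Proof.
rewrite /Rhat (rho_r1 bA) sweedler_tens; last by lin.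
rewrite (twR1r RQ) sweedler_tens; last by lin.
rewrite (lam_r1 lA) sweedler_tens; last by lin.
by rewrite mul1r mulr1.
Qed.

Lemma Qhat1r a : Qhat a 1 = a ⊗ 1.
Proof.
(* [rho_l_lam_l] is an identity in [B ⨂ A], so the target is first written as the flip of
   [1 ⊗ a]. *)
rewrite /Qhat; transitivity (\sw_(m, z <- 1 ⊗ a) z ⊗ m : A ⨂ B); last first.
  by rewrite sweedler_tens //; lin.
rewrite -(rho_l_lam_l lA a) sweedler_sweedler2; last by lin.
apply: eq_sweedler => am a0.
rewrite (twQ1r RQ) sweedler_tens; last by lin.
by under eq_sweedler do rewrite mulr1.
Qed.

Lemma Qhat1l b : Qhat 1 b = 1 ⊗ b.
Proof.
rewrite /Qhat (rho_l1 bA) sweedler_tens; last by lin.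
rewrite (twQ1l RQ) sweedler_tens; last by lin.
rewrite (lam_l1 lA) sweedler_tens; last by lin.
by rewrite mul1r mulr1.
Qed.

(** * Multiplicativity of the isomorphism *)

(** Both actions disappear: [rho_r_bullet] leaves only a right action, which [rho_l_mu_r] absorbs;
    [R_rho_l] then moves [rho_l] in front of [R]. *)
Lemma untilde_bullet x y c : untilde (x • y ⊗ c) =
  \sw_(x0, x1 <- rho_r x) \sw_(xm, x00 <- rho_l x0)
    \sw_(y0, y1 <- rho_r y) \sw_(ym, y00 <- rho_l y0)
      \sw_(y00R, x1R <- R (x1 ⊗ y00)) \sw_(x00Q, ymQ <- Q (x00 ⊗ ym))
        (x00Q * y00R) ⊗ x1R * y1 * c * xm * ymQ.
Proof.
rewrite untilde_tens (rho_r_bullet bA).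
transitivity (\sw_(x0, x1 <- rho_r x) \sw_(y0, y1 <- rho_r y)
  \sw_(y0R, x1R <- R (x1 ⊗ y0))
    \sw_(pm, p0 <- rho_l (\sw_(ym, y00 <- rho_l y0R) (x0 ◁ ym) * y00))
      p0 ⊗ x1R * y1 * c * pm).
  etransitivity; [sw_flatten|].
  apply: eq_sweedler => x0 x1; apply: eq_sweedler => y0 y1.
  apply: eq_sweedler => y0R x1R; symmetry.
  apply: (linear_app (h := fun p => \sw_(pm, p0 <- rho_l p)
    p0 ⊗ x1R * y1 * c * pm)).
  by lin.
rewrite [RHS](_ : _ = \sw_(x0, x1 <- rho_r x) \sw_(y0, y1 <- rho_r y)
  \sw_(xm, x00 <- rho_l x0) \sw_(ym, y00 <- rho_l y0)
      \sw_(y00R, x1R <- R (x1 ⊗ y00)) \sw_(x00Q, ymQ <- Q (x00 ⊗ ym))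
        (x00Q * y00R) ⊗ x1R * y1 * c * xm * ymQ); last by sw_eq.
apply: eq_sweedler => x0 x1; apply: eq_sweedler => y0 y1.
under eq_sweedler do rewrite (rho_l_mu_r lA).
sw_by3 (fun (m : B) (y : A) (d : B) => \sw_(xm, x00 <- rho_l x0)
  \sw_(x00Q, mQ <- Q (x00 ⊗ m)) (x00Q * y) ⊗ d * y1 * c * xm * mQ)
  (R_rho_l bA y0 x1).
Qed.

(** This combination arises from [untilde_bullet] when [y] comes from [Rhat]. The outer [rho_r]
    cancels [lam_r], and [R_rho_l] moves [rho_l] inside [R]. *)
Lemma rho_Rhat a b :
  \sw_(y, v <- Rhat b a) \sw_(y0, y1 <- rho_r y) \sw_(ym, y00 <- rho_l y0)
    (y1 * v) ⊗ y00 ⊗ ym =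
  \sw_(a0, a1 <- rho_r a) \sw_(am, a00 <- rho_l a0)
    \sw_(a00R, bR <- R (b ⊗ a00)) (bR * a1) ⊗ a00R ⊗ am.
Proof.
rewrite /Rhat.
transitivity (\sw_(a0, a1 <- rho_r a) \sw_(a0R, bR <- R (b ⊗ a0))
  \sw_(ym, y00 <- rho_l a0R) (bR * a1) ⊗ y00 ⊗ ym).
  etransitivity; [sw_flatten|].
  apply: eq_sweedler => a0 a1; apply: eq_sweedler => a0R bR.
  sw_by2 (fun (y0 : A) (c : B) => \sw_(ym, y00 <- rho_l y0)
    (c * bR * a1) ⊗ y00 ⊗ ym) (lam_r_rho_r lA a0R).
apply: eq_sweedler => a0 a1.
sw_by3 (fun (m : B) (y : A) (d : B) => (d * a1) ⊗ y ⊗ m) (R_rho_l bA a0 b).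
Qed.

(** Here [rho_r] separates [lam_l] from the [rho_l] cancelling it. Hence [rho_r_rho_l] is used
    twice: to swap the coactions before the cancellation, and to restore their order once [Q_rho_r]
    has moved [rho_r] inside [Q]. *)
Lemma rho_Qhat a b :
  \sw_(x, w <- Qhat a b) \sw_(x0, x1 <- rho_r x) \sw_(xm, x00 <- rho_l x0)
    x1 ⊗ x00 ⊗ w * xm =
  \sw_(a0, a1 <- rho_r a) \sw_(am, a00 <- rho_l a0)
    \sw_(a00Q, bQ <- Q (a00 ⊗ b)) a1 ⊗ a00Q ⊗ am * bQ.
Proof.
rewrite /Qhat.
transitivity (\sw_(am, a0 <- rho_l a) \sw_(a0Q, bQ <- Q (a0 ⊗ b))
  \sw_(z, c <- rho_r a0Q) c ⊗ z ⊗ am * bQ).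
  etransitivity; [sw_flatten|].
  apply: eq_sweedler => am a0; apply: eq_sweedler => a0Q bQ.
  transitivity (\sw_(n, z <- lam_l a0Q) \sw_(zm, z0 <- rho_l z)
    \sw_(z00, z01 <- rho_r z0) z01 ⊗ z00 ⊗ am * bQ * n * zm).
    apply: eq_sweedler => n z.
    sw_by3 (fun (m : B) (x : A) (d : B) => d ⊗ x ⊗ am * bQ * n * m)
      (rho_r_rho_l bA z).
  sw_by2 (fun (c : B) (z : A) => \sw_(z0, z1 <- rho_r z) z1 ⊗ z0 ⊗ am * bQ * c)
    (lam_l_rho_l lA a0Q).
transitivity (\sw_(am, a0 <- rho_l a) \sw_(a00, a01 <- rho_r a0)
  \sw_(z, bQ <- Q (a00 ⊗ b)) a01 ⊗ z ⊗ am * bQ).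
  apply: eq_sweedler => am a0.
  sw_by3 (fun (x : A) (d c : B) => d ⊗ x ⊗ am * c) (Q_rho_r bA a0 b).
symmetry.
sw_by3 (fun (m : B) (x : A) (d : B) => \sw_(z, bQ <- Q (x ⊗ b)) d ⊗ z ⊗ m * bQ)
  (rho_r_rho_l bA a).
Qed.

Lemma untildeM a b a' b' :
  untilde (\sw_(aQ, b'Q <- Qhat a b') \sw_(a'R, bR <- Rhat b a')
    (aQ • a'R) ⊗ bR * b'Q) =
  LRmul R Q (untilde (a ⊗ b)) (untilde (a' ⊗ b')).
Proof.
transitivity (\sw_(a0, a1 <- rho_r a) \sw_(am, a00 <- rho_l a0)
  \sw_(a'0, a'1 <- rho_r a') \sw_(a'm, a'00 <- rho_l a'0)
    \sw_(a00Q, b'Q <- Q (a00 ⊗ b')) \sw_(a'00R, bR <- R (b ⊗ a'00))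
      \sw_(a'00Rr, a1R <- R (a1 ⊗ a'00R)) \sw_(a00Qq, a'mQ <- Q (a00Q ⊗ a'm))
        (a00Qq * a'00Rr) ⊗ a1R * bR * (a'1 * am) * b'Q * a'mQ).
  rewrite (linear_app _ _ untilde_linear).
  transitivity (\sw_(x, w <- Qhat a b')
    \sw_(x0, x1 <- rho_r x) \sw_(xm, x00 <- rho_l x0)
    \sw_(y, v <- Rhat b a')
      \sw_(y0, y1 <- rho_r y) \sw_(ym, y00 <- rho_l y0)
        \sw_(y00R, x1R <- R (x1 ⊗ y00)) \sw_(x00Q, ymQ <- Q (x00 ⊗ ym))
          (x00Q * y00R) ⊗ x1R * y1 * (v * w) * xm * ymQ).
    apply: eq_sweedler => x w; rewrite (linear_app _ _ untilde_linear).
    under eq_sweedler do rewrite untilde_bullet.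
    by sw_eq.
  transitivity (\sw_(x, w <- Qhat a b')
    \sw_(x0, x1 <- rho_r x) \sw_(xm, x00 <- rho_l x0)
    \sw_(a'0, a'1 <- rho_r a') \sw_(a'm, a'00 <- rho_l a'0)
    \sw_(a'00R, bR <- R (b ⊗ a'00))
        \sw_(yR, x1R <- R (x1 ⊗ a'00R)) \sw_(x00Q, ymQ <- Q (x00 ⊗ a'm))
          (x00Q * yR) ⊗ x1R * (bR * a'1) * (w * xm) * ymQ).
    apply: eq_sweedler => x w; apply: eq_sweedler => x0 x1.
    apply: eq_sweedler => xm x00.
    sw_by3 (fun (c : B) (y : A) (m : B) => \sw_(yR, x1R <- R (x1 ⊗ y))
      \sw_(x00Q, mQ <- Q (x00 ⊗ m)) (x00Q * yR) ⊗ x1R * c * (w * xm) * mQ)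
      (rho_Rhat a' b).
  sw_by3 (fun (x1 : B) (x00 : A) (c : B) =>
    \sw_(a'0, a'1 <- rho_r a') \sw_(a'm, a'00 <- rho_l a'0)
    \sw_(a'00R, bR <- R (b ⊗ a'00))
        \sw_(yR, x1R <- R (x1 ⊗ a'00R)) \sw_(x00Q, ymQ <- Q (x00 ⊗ a'm))
          (x00Q * yR) ⊗ x1R * (bR * a'1) * c * ymQ) (rho_Qhat a b').
(* The two sides differ in the middle factor: expanding the product of the images gives [amR * a'1Q]
   where [a'1 * am] stands, and [rho_RQ] exchanges the two. *)
transitivity (\sw_(a0, a1 <- rho_r a) \sw_(am, a00 <- rho_l a0)
  \sw_(a'0, a'1 <- rho_r a') \sw_(a'm, a'00 <- rho_l a'0)
    \sw_(x, amR <- R (am ⊗ a'00)) \sw_(y, a'1Q <- Q (a00 ⊗ a'1))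
    \sw_(a00Q, b'Q <- Q (y ⊗ b')) \sw_(a'00R, bR <- R (b ⊗ x))
      \sw_(a'00Rr, a1R <- R (a1 ⊗ a'00R)) \sw_(a00Qq, a'mQ <- Q (a00Q ⊗ a'm))
        (a00Qq * a'00Rr) ⊗ a1R * bR * (amR * a'1Q) * b'Q * a'mQ).
  symmetry.
  sw_by5 (fun (c : B) (y x : A) (m d : B) =>
    \sw_(a00Q, b'Q <- Q (y ⊗ b')) \sw_(a'00R, bR <- R (b ⊗ x))
      \sw_(a'00Rr, a1R <- R (d ⊗ a'00R)) \sw_(a00Qq, a'mQ <- Q (a00Q ⊗ m))
        (a00Qq * a'00Rr) ⊗ a1R * bR * c * b'Q * a'mQ) (rho_RQ lA a a').
rewrite !untilde_tens.
have lmull t : linear (fun s => LRmul R Q s t) by exact: LRmul_linearl.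
have lmulr s : linear (LRmul R Q s) by exact: LRmul_linearr.
rewrite (linear_app _ _ (lmull _)); apply: eq_sweedler => a0 a1.
rewrite (linear_app _ _ (lmull _)); apply: eq_sweedler => am a00.
rewrite (linear_app _ _ (lmulr _)); apply: eq_sweedler => a'0 a'1.
rewrite (linear_app _ _ (lmulr _)); apply: eq_sweedler => a'm a'00.
(* [twRMl] treats the rightmost factor first, so this bracketing keeps the second product outside
   the binders; [twQMr] starts from the left. *)
rewrite LRmul_tens -(mulrA a1) !(twRMl RQ) !(twQMr RQ).
by sw_eq.
Qed.

(** * Compatibility of the two twisted maps *)

(** Both sides are brought to a form in which [R] and [Q] precede [lam_l] and [lam_r]: the left by
    [rho_l_Q_lam_r_R] and [lam_r_lam_l], the right by [rho_r_R_lam_l_Q]. [R_rho_l] matches the two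
    forms. *)
Lemma Rhat_Qhat_A a b b' :
  \sw_(aR, bR <- Rhat b a) \sw_(aRQ, b'Q <- Qhat aR b') bR ⊗ aRQ ⊗ b'Q =
  \sw_(aQ, b'Q <- Qhat a b') \sw_(aQR, bR <- Rhat b aQ) bR ⊗ aQR ⊗ b'Q.
Proof.
transitivity (\sw_(a0, a1 <- rho_r a) \sw_(am, a00 <- rho_l a0)
  \sw_(a00R, bR <- R (b ⊗ a00)) \sw_(w, b'Q <- Q (a00R ⊗ b'))
    \sw_(n, z <- lam_l w) \sw_(x, y <- lam_r z)
      (y * bR * a1) ⊗ x ⊗ am * b'Q * n).
  transitivity (\sw_(a0, a1 <- rho_r a) \sw_(am, a00 <- rho_l a0)
    \sw_(a00R, bR <- R (b ⊗ a00)) \sw_(w, b'Q <- Q (a00R ⊗ b'))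
      \sw_(x, y <- lam_r w) \sw_(n, z <- lam_l x)
        (y * bR * a1) ⊗ z ⊗ am * b'Q * n).
    rewrite /Rhat /Qhat.
    sw_by6 (fun (y : B) (x : A) (m d c e : B) => \sw_(n, z <- lam_l x)
      (y * c * d) ⊗ z ⊗ m * e * n) (rho_l_Q_lam_r_R lA a b b').
  apply: eq_sweedler => a0 a1; apply: eq_sweedler => am a00.
  apply: eq_sweedler => a00R bR; apply: eq_sweedler => w b'Q.
  sw_by3 (fun (n : B) (z : A) (y : B) => (y * bR * a1) ⊗ z ⊗ am * b'Q * n)
    (lam_r_lam_l lA w).
transitivity (\sw_(a0, a1 <- rho_r a) \sw_(a0R, bR <- R (b ⊗ a0))
  \sw_(am, a00R <- rho_l a0R) \sw_(w, b'Q <- Q (a00R ⊗ b'))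
    \sw_(n, z <- lam_l w) \sw_(x, y <- lam_r z)
      (y * bR * a1) ⊗ x ⊗ am * b'Q * n).
  apply: eq_sweedler => a0 a1; symmetry.
  sw_by3 (fun (m : B) (x : A) (c : B) => \sw_(w, b'Q <- Q (x ⊗ b'))
    \sw_(n, z <- lam_l w) \sw_(x, y <- lam_r z)
      (y * c * a1) ⊗ x ⊗ m * b'Q * n) (R_rho_l bA a0 b).
symmetry; rewrite /Rhat /Qhat.
sw_by6 (fun (z : A) (d m n c e : B) => \sw_(x, y <- lam_r z)
  (y * c * d) ⊗ x ⊗ m * e * n) (rho_r_R_lam_l_Q lA a b b').
Qed.

(** Each outer twisted map meets a triple product, split by [twQMr] or [twRMl]. Then [lam_r_RQ]
    trades [a'm * yQ] for [y * a'mR], [lam_l_RQ] trades [nR * a1] for [a1q * n], and [twRQB] at [b]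
    remains. *)
Lemma Rhat_Qhat_B a a' b :
  \sw_(aR, bR <- Rhat b a) \sw_(a'Q, bRQ <- Qhat a' bR) aR ⊗ bRQ ⊗ a'Q =
  \sw_(a'Q, bQ <- Qhat a' b) \sw_(aR, bQR <- Rhat bQ a) aR ⊗ bQR ⊗ a'Q.
Proof.
transitivity (\sw_(a0, a1 <- rho_r a) \sw_(a'm, a'0 <- rho_l a')
  \sw_(a0R, bR <- R (b ⊗ a0)) \sw_(a0Rr, a'mR <- R (a'm ⊗ a0R))
    \sw_(x, y <- lam_r a0Rr)
      \sw_(a'0Q, bRQ <- Q (a'0 ⊗ bR)) \sw_(a'0Qq, a1Q <- Q (a'0Q ⊗ a1))
        \sw_(n, z <- lam_l a'0Qq) x ⊗ (y * a'mR) * bRQ * a1Q * n ⊗ z).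
  transitivity (\sw_(a0, a1 <- rho_r a) \sw_(a'm, a'0 <- rho_l a')
    \sw_(a0R, bR <- R (b ⊗ a0)) \sw_(x, y <- lam_r a0R)
      \sw_(a'0q, yQ <- Q (a'0 ⊗ y))
      \sw_(a'0Q, bRQ <- Q (a'0q ⊗ bR)) \sw_(a'0Qq, a1Q <- Q (a'0Q ⊗ a1))
        \sw_(n, z <- lam_l a'0Qq) x ⊗ (a'm * yQ) * bRQ * a1Q * n ⊗ z).
    rewrite /Rhat /Qhat; etransitivity; [sw_flatten|].
    under eq_sweedler => a0 a1 do under eq_sweedler => a0R bR do
      under eq_sweedler => x y do under eq_sweedler => a'm a'0 do
        rewrite !(twQMr RQ).
    by sw_eq.
  sw_by5 (fun (x : A) (c : B) (y : A) (d e : B) =>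
      \sw_(a'0Q, bRQ <- Q (y ⊗ e)) \sw_(a'0Qq, a1Q <- Q (a'0Q ⊗ d))
        \sw_(n, z <- lam_l a'0Qq) x ⊗ c * bRQ * a1Q * n ⊗ z)
    (lam_r_RQ lA a a' b).
symmetry.
transitivity (\sw_(a0, a1 <- rho_r a) \sw_(a'm, a'0 <- rho_l a')
  \sw_(a'0Q, bQ <- Q (a'0 ⊗ b)) \sw_(a'0Qq, a1Q <- Q (a'0Q ⊗ a1))
    \sw_(n, z <- lam_l a'0Qq)
      \sw_(a0R, bQR <- R (bQ ⊗ a0)) \sw_(a0Rr, a'mR <- R (a'm ⊗ a0R))
        \sw_(x, y <- lam_r a0Rr) x ⊗ y * a'mR * bQR * (a1Q * n) ⊗ z).
  transitivity (\sw_(a0, a1 <- rho_r a) \sw_(a'm, a'0 <- rho_l a')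
    \sw_(a'0Q, bQ <- Q (a'0 ⊗ b)) \sw_(n, z <- lam_l a'0Q)
      \sw_(a0r, nR <- R (n ⊗ a0))
      \sw_(a0R, bQR <- R (bQ ⊗ a0r)) \sw_(a0Rr, a'mR <- R (a'm ⊗ a0R))
        \sw_(x, y <- lam_r a0Rr) x ⊗ y * a'mR * bQR * (nR * a1) ⊗ z).
    rewrite /Rhat /Qhat; etransitivity; [sw_flatten|].
    under eq_sweedler => a'm a'0 do under eq_sweedler => a'0Q bQ do
      under eq_sweedler => n z do under eq_sweedler => a0 a1 do
        rewrite -(mulrA a'm) !(twRMl RQ).
    by sw_eq.
  sw_by5 (fun (c : B) (z : A) (m : B) (y : A) (e : B) =>
      \sw_(a0R, bQR <- R (e ⊗ y)) \sw_(a0Rr, a'mR <- R (m ⊗ a0R))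
        \sw_(x, y <- lam_r a0Rr) x ⊗ y * a'mR * bQR * c ⊗ z)
    (lam_l_RQ lA a a' b).
symmetry; apply: eq_sweedler => a0 a1; apply: eq_sweedler => a'm a'0.
sw_by3 (fun (w : A) (c : B) (v : A) =>
  \sw_(w', a'mR <- R (a'm ⊗ w)) \sw_(x, y <- lam_r w')
    \sw_(v', a1Q <- Q (v ⊗ a1)) \sw_(n, z <- lam_l v')
      x ⊗ y * a'mR * c * a1Q * n ⊗ z) (twRQB RQ a0 a'0 b).
Qed.
End Tilde.

(** * Assembly of the twisting and the isomorphism *)

Theorem theorem4p3 (k : fieldType) (A B : algType k)
    (R : {linear B ⨂ A -> A ⨂ B}) (Q : {linear A ⨂ B -> A ⨂ B})
    (RQ : LR_twisting R Q)
    (mu_l : {linear B ⨂ A -> A}) (mu_r : {linear A ⨂ B -> A})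
    (rho_r : {linear A -> A ⨂ B}) (rho_l : {linear A -> B ⨂ A})
    (bA : bullet_axioms R Q mu_l mu_r rho_r rho_l)
    (lam_r : {linear A -> A ⨂ B}) (lam_l : {linear A -> B ⨂ A})
    (lA : lambda_axioms R Q mu_l mu_r rho_r rho_l lam_r lam_l) :
  exists RQtilde : @LR_twisting k (tildeA RQ bA) B
           (Rtilde RQ bA lam_r) (Qtilde RQ bA lam_l),
  exists phi : {lrmorphism LRalg RQtilde -> LRalg RQ},
    bijective phi /\
    forall (a : tildeA RQ bA) (b : B),
      phi (a ⊗ b) =
      \sw_(a0, a1 <- rho_r a) \sw_(a0m, a00 <- rho_l a0) a00 ⊗ a1 * b * a0m.
Proof.
pose R' : {linear B ⨂ tildeA RQ bA -> tildeA RQ bA ⨂ B} := Rtilde RQ bA lam_r.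
pose Q' : {linear tildeA RQ bA ⨂ B -> tildeA RQ bA ⨂ B} := Qtilde RQ bA lam_l.
pose f (t : tildeA RQ bA ⨂ B) : A ⨂ B := untilde rho_r rho_l t.
have R'E (b : B) (a : tildeA RQ bA) : R' (b ⊗ a) = Rhat R rho_r lam_r b a.
  by rewrite /= /Rtilde sweedler_tens //; lin.
have Q'E (b : B) (a : tildeA RQ bA) : Q' (a ⊗ b) = Qhat Q rho_l lam_l a b.
  by rewrite /= /Qtilde sweedler_tens //; lin.
have fL : linear f by exact: untilde_linear.
(* [LRmul] is defined for arbitrary linear maps, so multiplicativity can precede the proof that [R']
   and [Q'] form a twisting. *)
have fM x y : f (LRmul R' Q' x y) = LRmul R Q (f x) (f y).
  have lf s : linear (fun t => LRmul R Q t s) by exact: LRmul_linearl.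
  have lfr s : linear (LRmul R Q s) by exact: LRmul_linearr.
  have lf' s : linear (fun t => LRmul R' Q' t s) by exact: LRmul_linearl.
  have lfr' s : linear (LRmul R' Q' s) by exact: LRmul_linearr.
  move: x; apply: tens_ind => [||a b].
  - exact: linear_compose fL (lf' _).
  - exact: linear_compose (lf _) fL.
  move: y; apply: tens_ind => [||a' b'].
  - exact: linear_compose fL (lfr' _).
  - exact: linear_compose (lfr _) fL.
  by rewrite LRmul_tens Q'E; under eq_sweedler do rewrite R'E; exact: untildeM.
have f_bij : bijective f by exact: untilde_bij lA.
have f1 : f (1 ⊗ 1) = 1 ⊗ 1.
  rewrite [LHS]untilde_tens (rho_r1 bA) sweedler_tens; last by lin.
  by rewrite (rho_l1 bA) sweedler_tens ?mulr1 //; lin.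
have RQt : LR_twisting R' Q'.
  apply: LR_twisting_of_assoc.
  - by move=> a; rewrite R'E; exact (Rhat1l RQ lA a).
  - by move=> b; rewrite R'E; exact (Rhat1r RQ bA lA b).
  - by move=> a; rewrite Q'E; exact (Qhat1r RQ lA a).
  - by move=> b; rewrite Q'E; exact (Qhat1l RQ bA lA b).
  - move=> a b b'; rewrite R'E Q'E.
    under eq_sweedler do rewrite Q'E.
    under [RHS]eq_sweedler do rewrite R'E.
    exact (Rhat_Qhat_A bA lA a b b').
  - move=> a a' b; rewrite R'E Q'E.
    under eq_sweedler do rewrite Q'E.
    under [RHS]eq_sweedler do rewrite R'E.
    exact (Rhat_Qhat_B RQ lA a a' b).
  by move=> x y z; apply: (bij_inj f_bij); rewrite !fM (LRmulA RQ).
exists RQt.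
(* The algebra structure on the source exists only now that [RQt] is available, so [f] is retyped
   before its morphism structure is packed. *)
pose g : LRalg RQt -> LRalg RQ := f.
pose gL := GRing.isLinear.Build k (LRalg RQt) (LRalg RQ) *:%R g fL.
pose gM := GRing.isMonoidMorphism.Build (LRalg RQt) (LRalg RQ) g (f1, fM).
pose phi : {lrmorphism LRalg RQt -> LRalg RQ} := HB.pack g gL gM.
by exists phi; split=> // a b; exact: untilde_tens.
Qed.
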